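(* Let $1\le q\le p<\infty$ and $s\in\mathbb{N}$. For $i=1,\dots,s$ let $\Omega_i$ be a compact set (in some Euclidean space) with a probability measure $\mu_i$, and let $X(N_i,i)\subset\mathcal{C}(\Omega_i)$ be a subspace with $\dim X(N_i,i)=N_i$ such that $$\varepsilon_k(X^q(N_i,i),L_\infty)\le B_i(N_i/k)^{1/q},\quad 1\le k<\infty,\quad i=1,\dots,s,$$ where $B_i\ge1$. Then for a large enough constant $C(p,q,s)$ (depending only on $p,q,s$) there exists a set $\xi(m)=\{\xi^j\}_{j=1}^m\subset\Omega:=\Omega_1\times\cdots\times\Omega_s$ with a tensor product structure of $$m\le C(p,q,s)\prod_{i=1}^sB_i^pN_i^{p/q}(\log_2(2B_iN_i))^2$$ points such that for any $f\in\mathbf{X}_{\mathbf{N}}$ $$\left(\frac12\right)^s\|f\|_p^p\le\frac1m\sum_{j=1}^m|f(\xi^j)|^p\le\left(\frac32\right)^s\|f\|_p^p.$$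
   Context: $\mathbf{N}:=(N_1,\dots,N_s)$ and $\mathbf{X}_{\mathbf{N}}:=\operatorname{span}\{f_1(\mathbf{x}^1)\times\cdots\times f_s(\mathbf{x}^s):\ f_i\in X(N_i,i),\ i=1,\dots,s\}\subset\mathcal{C}(\Omega_1\times\cdots\times\Omega_s)$. On $\Omega$ one uses the product measure $\mu=\mu_1\times\cdots\times\mu_s$, and $\|f\|_p:=\left(\int_\Omega|f|^p\,d\mu\right)^{1/p}$. $L_\infty$ denotes the space of continuous functions with the uniform norm. $X^q(N_i,i):=\{f\in X(N_i,i):\|f\|_{L_q(\Omega_i,\mu_i)}\le1\}$. For a Banach space $X$ and compact $A\subset X$, the entropy numbers are, for $k=0,1,\dots$, $\varepsilon_k(A,X):=\inf\{\varepsilon>0:\ \exists\,y^1,\dots,y^{2^k}\in A,\ A\subseteq\bigcup_{j=1}^{2^k}B_X(y^j,\varepsilon)\}$ with $B_X(y,r)=\{x\in X:\|x-y\|\le r\}$. A point set $\xi(m)$ has a tensor product structure if $\xi(m)=\xi(m_1,1)\times\cdots\times\xi(m_s,s)$, where $\xi(m_i,i)$ is a family of $m_i$ points of $\Omega_i$ and $m=\prod_i m_i$. Repetitions among points are allowed. *)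

(* Defs.v *)
From HB Require Import structures.
From mathcomp Require Import all_boot all_order all_algebra.
From mathcomp Require Import all_classical all_reals all_analysis.
From mathcomp Require Import measurable_realfun.

Set Implicit Arguments.
Unset Strict Implicit.
Unset Printing Implicit Defensive.

Import Order.TTheory GRing.Theory Num.Theory.
Import numFieldNormedType.Exports.

Local Open Scope classical_set_scope.
Local Open Scope ring_scope.

(* The subset [A] as a space of its own: subspace topology and Borel
   sigma-algebra.  Measurable types are pointed in the library, hence the base
   point [x0], which plays no other role. *)
Definition borel_sub {T : topologicalType} {A : set T} (x0 : A) : Type := A.

Section borel_sub_instances.
Context {T : topologicalType} {A : set T} (x0 : A).

HB.instance Definition _ := Topological.copy (borel_sub x0) (set_type A).
HB.instance Definition _ := isPointed.Build (borel_sub x0) x0.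
HB.instance Definition _ := Measurable.copy (borel_sub x0)
  (g_sigma_algebraType (@open (borel_sub x0))).

End borel_sub_instances.

Section product_space.
Context {s : nat} {d : 'I_s -> measure_display}.
Variable T : forall i, measurableType (d i).

Definition cylinders : set (set (forall i, T i)) :=
  [set A | exists i, exists2 B : set (T i),
     measurable B & A = (fun x => x i) @^-1` B].

Definition pi_space := g_sigma_algebraType cylinders.

HB.instance Definition _ := Measurable.on pi_space.

Lemma measurable_coord i : measurable_fun setT (fun x : pi_space => x i).
Proof.
by move=> _ B mB; rewrite setTI; apply: sub_sigma_algebra; exists i, B.
Qed.

Lemma measurable_to_pi_space d' (S : measurableType d') (g : S -> pi_space) :
  (forall i, measurable_fun setT (fun x => g x i)) -> measurable_fun setT g.
Proof.
move=> mg; apply: (@measurability _ _ _ _ setT g cylinders) => //.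
move=> _ [_ [i [B mB ->]] <-]; rewrite setTI.
by have := mg i measurableT _ mB; rewrite setTI.
Qed.

Lemma measurable_dfwith i :
  measurable_fun setT (fun z : pi_space * T i => dfwith z.1 i z.2 : pi_space).
Proof.
apply: measurable_to_pi_space => j.
have [<-|ij] := eqVneq i j.
  have -> : (fun z : pi_space * T i => dfwith z.1 i z.2 i) = snd.
    by apply/funext => z; rewrite dfwithin.
  exact: measurable_snd.
have -> : (fun z : pi_space * T i => dfwith z.1 i z.2 j) =
    (fun x : pi_space => x j) \o fst.
  by apply/funext => z; rewrite dfwithout.
apply: measurableT_comp; first exact: measurable_coord. exact: measurable_fst.
Qed.

Lemma measurable_dfwith1 (x : pi_space) i :
  measurable_fun setT (fun y : T i => dfwith x i y : pi_space).
Proof.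
apply: measurable_to_pi_space => j.
have [<-|ij] := eqVneq i j.
  have -> : (fun y : T i => dfwith x i y i) = id.
    by apply/funext => y; rewrite dfwithin.
  exact: measurable_id.
have -> : (fun y : T i => dfwith x i y j) = cst (x j).
  by apply/funext => y; rewrite dfwithout.
exact: measurable_cst.
Qed.

End product_space.

Section product_measure.
Context {R : realType} {s : nat} {d : 'I_s -> measure_display}.
Context {T : forall i, measurableType (d i)}.
Variable mu : forall i, probability (T i) R.
Local Open Scope ereal_scope.

Definition integral_coord (i : 'I_s) (g : pi_space T -> \bar R) :
  pi_space T -> \bar R := fun x => \int[mu i]_y g (dfwith x i y).

Definition iter_integral (r : seq 'I_s) (g : pi_space T -> \bar R) :
  pi_space T -> \bar R := foldr integral_coord g r.

(* The iterated integral of the indicator of [A] over all coordinates; the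
   value does not depend on the evaluation point.  [product_measure_box]
   is the usual characterization of the product measure. *)
Definition product_measure (A : set (pi_space T)) : \bar R :=
  iter_integral (enum 'I_s) (fun x => (\1_A x)%:E) point.

Lemma iter_integral_ge0 r (g : pi_space T -> \bar R) :
  (forall x, 0 <= g x) -> forall x, 0 <= iter_integral r g x.
Proof.
by move=> g0; elim: r => //= i r IH x; apply: integral_ge0 => y _; exact: IH.
Qed.

Lemma measurable_iter_integral r (g : pi_space T -> \bar R) :
  measurable_fun setT g ->
  (forall x, 0 <= g x) -> measurable_fun setT (iter_integral r g).
Proof.
move=> mg g0; elim: r => //= i r IH.
pose h (z : pi_space T * T i) := iter_integral r g (dfwith z.1 i z.2).
apply: (@measurable_fun_fubini_tonelli_F _ _ _ _ _ (mu i) h).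
  by apply: (measurableT_comp IH); exact: measurable_dfwith.
by move=> z; exact: iter_integral_ge0.
Qed.

Lemma iter_integral_nneseries r (g : (pi_space T -> \bar R)^nat) :
  (forall n, measurable_fun setT (g n)) -> (forall n x, 0 <= g n x) ->
  iter_integral r (fun x => \sum_(n <oo) g n x) =
  fun x => \sum_(n <oo) iter_integral r (g n) x.
Proof.
move=> mg g0; elim: r => //= i r ->; apply/funext => x.
rewrite /integral_coord integral_nneseries//.
- move=> n; apply: (measurableT_comp (measurable_iter_integral _ (mg n) (g0 n))).
  exact: measurable_dfwith1.
- by move=> n y _; exact: iter_integral_ge0.
Qed.

Let indic_measurable (A : set (pi_space T)) : measurable A ->
  measurable_fun setT (fun x => (\1_A x : R)%:E).
Proof. by move=> mA; exact/measurable_EFinP/measurable_indic. Qed.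

Let indic_ge0 (A : set (pi_space T)) x : 0 <= (\1_A x : R)%:E.
Proof. by rewrite lee_fin. Qed.

Lemma product_measure_box (A : forall i, set (T i)) :
  (forall i, measurable (A i)) ->
  product_measure [set x | forall i, A i (x i)] = \prod_i mu i (A i).
Proof.
move=> mA.
have iterE r x : uniq r -> iter_integral r
    (fun x => (\prod_j (\1_(A j) (x j) : R))%:E) x =
    (\prod_j (if j \in r then fine (mu j (A j)) else \1_(A j) (x j)))%:E.
  elim: r x => [x _|i r IH x /= /andP[ir ur]].
    by congr (_%:E); apply: eq_bigr => j _.
  rewrite /integral_coord.
  under eq_integral => y _.
    rewrite IH// (bigD1 i)//= (negbTE ir) dfwithin.
    under eq_bigr => j ji do rewrite dfwithout 1?eq_sym//.
    rewrite EFinM muleC; over.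
  rewrite ge0_integralZl//=; last 2 first.
  - exact/measurable_EFinP/measurable_indic.
  - by rewrite lee_fin; apply: prodr_ge0 => j _; case: ifP => // _; exact: fine_ge0.
  rewrite integral_indic// setIT [in RHS](bigD1 i)//= mem_head muleC EFinM.
  rewrite fineK ?fin_num_measure//; congr (_ * (_)%:E).
  by apply: eq_bigr => j ji; rewrite in_cons (negbTE ji).
have -> : product_measure [set x | forall i, A i (x i)] =
    iter_integral (enum 'I_s)
      (fun x => (\prod_j (\1_(A j) (x j) : R))%:E) point.
  congr (iter_integral _ _ _); apply/funext => x; congr (_%:E).
  have [Ax|] := pselect (forall i, A i (x i)).
    rewrite indicE mem_set//= big1// => i _.
    by rewrite indicE mem_set.
  move=> nA; have /existsNP[i Ai] := nA.
  by rewrite indicE memNset// (bigD1 i)//= indicE memNset// mul0r.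
rewrite iterE ?enum_uniq// -prodEFin; apply: eq_bigr => j _.
by rewrite mem_enum inE fineK ?fin_num_measure.
Qed.

Let product_measure0 : product_measure set0 = 0.
Proof.
rewrite /product_measure; set g := fun x => _.
have : forall r, iter_integral r g = cst 0.
  elim=> /= [|i r ->]; first by apply/funext => x; rewrite /g indic0.
  by apply/funext => x; rewrite /integral_coord integral0_eq.
by move=> ->.
Qed.

Let product_measure_ge0 A : 0 <= product_measure A.
Proof. exact: iter_integral_ge0. Qed.

Let product_measure_sigma_additive : semi_sigma_additive product_measure.
Proof.
move=> F mF tF mUF.
suff -> : product_measure (\bigcup_n F n) = \sum_(n <oo) product_measure (F n).
  exact: is_cvg_nneseries.
have -> : product_measure (\bigcup_n F n) = iter_integral (enum 'I_s)
    (fun x => \sum_(n <oo) (\1_(F n) x : R)%:E) point.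
  congr (iter_integral _ _ _); apply/funext => x.
  exact: indic_bigcup.
by rewrite iter_integral_nneseries// => n; exact: indic_measurable.
Qed.

HB.instance Definition _ := isMeasure.Build _ _ _ product_measure
  product_measure0 product_measure_ge0 product_measure_sigma_additive.

Let product_measure_setT : product_measure setT = 1.
Proof.
have := @product_measure_box (fun=> setT) (fun=> measurableT).
under eq_bigr do rewrite probability_setT.
rewrite big1// => <-; congr product_measure.
by apply/seteqP; split.
Qed.

HB.instance Definition _ :=
  Measure_isProbability.Build _ _ _ product_measure product_measure_setT.

End product_measure.

Section function_spaces.
Context {R : realType} {T : Type}.

Definition lin_span (G : set (T -> R)) : set (T -> R) :=
  [set f | exists n (c : 'I_n -> R) (g : 'I_n -> T -> R),
     (forall k, G (g k)) /\ f = (fun x => \sum_(k < n) c k * g k x)].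

Definition lin_indep n (b : 'I_n -> T -> R) : Prop :=
  forall c : 'I_n -> R,
    (forall x, \sum_(k < n) c k * b k x = 0) -> forall k, c k = 0.

Definition subspace_of_dim (X : set (T -> R)) (n : nat) : Prop :=
  exists2 b : 'I_n -> T -> R, lin_indep b & X = lin_span (range b).

Definition uniform_norm (f : T -> R) : \bar R :=
  ereal_sup (range (fun x => `|f x|%:E)).

End function_spaces.

(* Extended-real valued: [+oo] when no radius works, as for an unbounded [A]. *)
Definition entropy_number {R : realType} {V : zmodType} (norm : V -> \bar R)
    (A : set V) (k : nat) : \bar R :=
  ereal_inf [set e%:E | e in [set e : R | 0 < e /\
    exists y : 'I_(2 ^ k) -> V, (forall j, A (y j)) /\
      A `<=` \bigcup_j [set x | (norm (x - y j)%R <= e%:E)%E]]].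

Definition Lnorm_ball {R : realType} {d} {T : measurableType d}
    (mu : probability T R) (q : R) (X : set (T -> R)) : set (T -> R) :=
  [set f | X f /\ ('N[mu]_q%:E[EFin \o f] <= 1)%E].

Definition tensor_space {R : realType} {s : nat} {T : 'I_s -> Type}
    (X : forall i, set (T i -> R)) : set ((forall i, T i) -> R) :=
  lin_span [set F | exists f : forall i, T i -> R,
    (forall i, X i (f i)) /\ F = (fun x => \prod_(i < s) f i (x i))].

(* The points [xi j], [j < m], enumerate, with multiplicity, the product of
   families of [mm i] points of the factors. *)
Definition tensor_product_structure {s : nat} {T : 'I_s -> Type} {m : nat}
    (xi : 'I_m -> forall i, T i) : Prop :=
  exists (mm : 'I_s -> nat) (z : forall i, 'I_(mm i) -> T i)
         (h : 'I_m -> {dffun forall i, 'I_(mm i)}),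
    [/\ m = (\prod_(i < s) mm i)%N, bijective h
      & forall j i, xi j i = z i (h j i)].

Definition log2 {R : realType} (x : R) : R := ln x / ln 2.

(* Main.v *)
Require Import Defs.
From HB Require Import structures.
From mathcomp Require Import all_boot all_order all_algebra.
From mathcomp Require Import all_classical all_reals all_analysis.
From mathcomp Require Import measurable_realfun ring lra.

Set Implicit Arguments.
Unset Strict Implicit.
Unset Printing Implicit Defensive.

Import Order.TTheory GRing.Theory Num.Theory.
Import numFieldNormedType.Exports.

Local Open Scope classical_set_scope.
Local Open Scope ring_scope.

(** The case s = 1 carries the analysis, and the general case follows by
    applying it one coordinate at a time.

    One factor.  Put V = B N^(1/q).  By Young's inequality a function of unit
    L_p norm lies in the unit L_q ball, so the entropy hypothesis bounds it
    uniformly by 2V ([ball_bounded]) and, at every radius r, provides a net of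
    2^k functions with k <= 1 + (2V/r)^p ([net_of_radius]).  Cut the range of
    |f|^p into levels U_0 < U_1 < ..., in geometric progression with ratio
    K = 21/20.  At level j take a net of radius proportional to u_j = U_j^(1/p)
    and replace the set {|f| >= u_j} by {|y_j| >= u_j}, where y_j is the net
    element near f.  The step function H = sum_j (U_j - U_(j-1)) 1_{|y_j| >= u_j}
    then equals |f|^p up to the factor K^2 and the additive error K U_0
    ([staircase_le], [staircase_ge], [level_compare]).  It is linear in the
    indicators of sets taken from families of 2^(k_j) members, so it suffices
    that the sample estimates well the measures of these finitely many sets.

    By Chernoff's bound, m independent points estimate mu(D) up to
    2 lam (mu(D) + t), except with probability 2 exp(-2 lam^2 m t).  With the
    tolerance t_j = 1/(n U_j) at the j-th of the n levels the errors add up to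
    2 lam (int H + 1), and the probabilities of failure add up to at most 1
    once m is a large multiple of n^2 V^p, because U_j k_j = O(V^p) at every
    level.  The number n of levels is O(log(2BN)), whence the count
    B^p N^(p/q) log^2.  The points are selected one after the other, keeping
    the conditional expectation of the total failure bounded
    ([exists_sample_sum_le]).

    Several factors.  Every section of |f|^p along a coordinate i is the p-th
    power of a function of X(N_i,i), so averaging over the sample of coordinate
    i and integrating over that coordinate agree up to the factors 1/2 and 3/2.
    Averaging over the sample of a coordinate preserves this property
    ([coord_discretized_sample]); hence the integrals in the iterated integral
    can be exchanged for averages, innermost first, each at the cost of one
    such factor ([iter_discretized]). *)

(** * Integrals of real-valued functions *)

Lemma ge0_integral_EFinZl {R : realType} d (T : measurableType d)
    (mu : {measure set T -> \bar R}) (c : R) (f : T -> R) :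
  measurable_fun setT f -> 0 <= c -> (forall x, 0 <= f x) ->
  (\int[mu]_x (c * f x)%:E = c%:E * \int[mu]_x (f x)%:E)%E.
Proof.
move=> mf c0 f0; under eq_integral do rewrite EFinM.
apply: ge0_integralZl => //; first exact/measurable_EFinP.
by move=> x _; rewrite lee_fin.
Qed.

Lemma ge0_le_integral_EFin {R : realType} d (T : measurableType d)
    (mu : {measure set T -> \bar R}) (f g : T -> R) :
  measurable_fun setT f -> measurable_fun setT g -> (forall x, 0 <= f x) ->
  (forall x, f x <= g x) ->
  (\int[mu]_x (f x)%:E <= \int[mu]_x (g x)%:E)%E.
Proof.
move=> mf mg f0 fg; apply: ge0_le_integral => //.
- by move=> x _; rewrite lee_fin.
- exact/measurable_EFinP.
- exact/measurable_EFinP.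
- by move=> x _; rewrite lee_fin.
Qed.

Lemma integral_EFin_indic {R : realType} d (T : measurableType d)
    (mu : probability T R) (D : set T) : measurable D ->
  (\int[mu]_x (\1_D x)%:E = (fine (mu D))%:E)%E.
Proof. by move=> mD; rewrite integral_indic// setIT fineK// fin_num_measure. Qed.

Lemma integral_probability_cst {R : realType} d (T : measurableType d)
    (mu : probability T R) (c : R) : (\int[mu]_x c%:E = c%:E)%E.
Proof. by rewrite -[RHS]mule1 -(probability_setT mu); exact: integral_cst. Qed.

Lemma measurable_norm_powR {R : realType} d (T : measurableType d) (p : R)
    (f : T -> R) :
  measurable_fun setT f -> measurable_fun setT (fun x => `|f x| `^ p).
Proof.
move=> mf; apply: (measurableT_comp (measurable_powR _)).
exact: measurableT_comp.
Qed.

(** * Selecting sample points by conditional expectations *)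

Lemma exists_le_integral {R : realType} d (T : measurableType d)
    (mu : probability T R) (f : T -> R) (W : R) :
  measurable_fun setT f -> 0 <= W -> (forall x, 0 <= f x) ->
  (\int[mu]_x (f x)%:E <= W%:E)%E -> exists x, f x <= W.
Proof.
move=> mf W0 f0 fW; apply: contrapT => /forallNP fgtW.
have hgt x : 0 < f x - W by rewrite subr_gt0 ltNge; exact/negP/fgtW.
have mh : measurable_fun setT (fun x => (f x - W)%:E).
  exact/measurable_EFinP/measurable_funB.
have h0 : (\int[mu]_x (f x - W)%:E = 0)%E.
  apply/eqP; rewrite eq_le integral_ge0 ?andbT; last first.
    by move=> x _; rewrite lee_fin ltW.
  rewrite -(leeD2rE (x := W%:E))// add0e (le_trans _ fW)//.
  have <- : (\int[mu]_x W%:E = W%:E)%E.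
    exact: integral_probability_cst.
  rewrite -ge0_integralD//=.
  - by apply: ge0_le_integral => //= [x _|||x _];
      rewrite ?adde_ge0 ?lee_fin ?subrK// ?ltW//;
      [apply: emeasurable_funD => // |exact/measurable_EFinP].
  - by move=> x _; rewrite lee_fin ltW.
have /(ae_eq_integral_abs mu measurableT mh) : (\int[mu]_x `|(f x - W)%:E| = 0)%E.
  by rewrite -h0; apply: eq_integral => x _; rewrite gee0_abs// lee_fin ltW.
move=> [A [mA A0 /= sub]].
suff AT : A = setT.
  have /eqP := probability_setT mu; rewrite -AT => /eqP A1.
  by have /eqP := etrans (esym A1) A0; rewrite onee_eq0.
rewrite -subTset => x _; apply: sub => /= /(_ I)/eqP; rewrite eqe.
by rewrite gt_eqF.
Qed.

(** The method of conditional expectations.  If the points were independent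
    with law [mu], every product would have expectation at most 1; choosing the
    first point so that the weighted sum does not exceed its mean and absorbing
    the values taken there into the weights leaves the same problem with one
    point less.  The weights are general for the sake of this induction. *)
Lemma exists_sample_sum_le {R : realType} d (T : measurableType d)
    (mu : probability T R) (I : finType) (G : I -> T -> R) (m : nat) (w : I -> R) :
  (forall i, measurable_fun setT (G i)) -> (forall i x, 0 <= G i x) ->
  (forall i, (\int[mu]_x (G i x)%:E <= 1)%E) -> (forall i, 0 <= w i) ->
  exists z : nat -> T,
    \sum_i w i * \prod_(k < m) G i (z k) <= \sum_i w i.
Proof.
move=> mG G0 G1; elim: m w => [|m IH] w w0.
  exists (fun=> point); under eq_bigr do rewrite big_ord0 mulr1.
  exact: lexx.
have [x xle] : exists x, \sum_i w i * G i x <= \sum_i w i.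
  apply: (exists_le_integral (mu := mu)).
  - by apply: measurable_sum => i; exact: measurable_funM.
  - exact: sumr_ge0.
  - by move=> x; apply: sumr_ge0 => i _; rewrite mulr_ge0.
  under eq_integral do rewrite -sumEFin.
  rewrite ge0_integral_sum//; last 2 first.
  - by move=> i; apply/measurable_EFinP/measurable_funM.
  - by move=> i y _; rewrite lee_fin mulr_ge0.
  rewrite -sumEFin; apply: lee_sum => i _; rewrite ge0_integral_EFinZl//.
  by rewrite -[leRHS]mule1 lee_wpmul2l// lee_fin.
have [|z zle] := IH (fun i => w i * G i x); first by move=> i; rewrite mulr_ge0.
exists (fun k => if k is k'.+1 then z k' else x).
rewrite (le_trans _ xle)// (le_trans _ zle)//.
by apply: ler_sum => i _; rewrite big_ord_recl mulrA.
Qed.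

Lemma expR_le_quad {R : realType} (t : R) : t <= 1 / 2 ->
  expR t <= 1 + t + 2 * t ^+ 2.
Proof.
move=> t12; have t1 : 0 < 1 - t by lra.
have : expR t <= (1 - t)^-1.
  rewrite -[t in leLHS]opprK expRN lef_pV2 ?posrE ?expR_gt0//.
  exact: expR_ge1Dx.
move=> /le_trans; apply; rewrite -[leLHS]mul1r ler_pdivrMr//.
have : 0 <= t ^+ 2 * (1 - 2 * t) by rewrite mulr_ge0 ?sqr_ge0//; lra.
nra.
Qed.

(** The exponential moment behind Chernoff's bound.  It is stated for [t] of
    either sign so that it controls both deviations, and the correction
    [2 * t ^+ 2 * v] is proportional to the measure [v] of the set, which makes
    the resulting error relative to that measure. *)
Lemma integral_expR_indic_le1 {R : realType} d (T : measurableType d)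
    (mu : probability T R) (D : set T) (t v : R) :
  measurable D -> mu D = v%:E -> t <= 1 / 2 ->
  (\int[mu]_x (expR (t * (\1_D x - v) - 2 * t ^+ 2 * v))%:E <= 1)%E.
Proof.
move=> mD muD t12.
have v0 : 0 <= v by rewrite -lee_fin -muD.
have v1 : v <= 1 by rewrite -lee_fin -muD probability_le1.
pose c := expR (- t * v - 2 * t ^+ 2 * v).
have cE x : expR (t * (\1_D x - v) - 2 * t ^+ 2 * v) =
    c * (expR t * \1_D x + \1_(~` D) x).
  rewrite !indicE in_setC; case: (x \in D) => /=.
    by rewrite [expR t * _]mulr1 addr0 -expRD; congr expR; ring.
  by rewrite [expR t * _]mulr0 [X in c * X]add0r [c * _]mulr1; congr expR; ring.
under eq_integral do rewrite cE EFinM EFinD EFinM.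
have mI (A : set T) : measurable A -> measurable_fun setT (fun x => (\1_A x : R)%:E).
  by move=> mA; exact/measurable_EFinP/measurable_indic.
have mDC := measurableC mD.
rewrite ge0_integralZl//=; last 3 first.
- apply: emeasurable_funD; last exact: mI.
  by apply: emeasurable_funM => //; exact: mI.
- by move=> x _; rewrite -EFinM -EFinD lee_fin addr_ge0// mulr_ge0// expR_ge0.
- by rewrite lee_fin expR_ge0.
rewrite ge0_integralD//=; last 2 first.
- by apply: emeasurable_funM => //; exact: mI.
- exact: mI.
rewrite ge0_integralZl//=; last first.
- exact: mI.
have iD : (\int[mu]_x (\1_D x)%:E = v%:E)%E by rewrite integral_indic// setIT.
have iDC : (\int[mu]_x (\1_(~` D) x)%:E = (1 - v)%:E)%E.
  rewrite integral_indic// setIT; apply: etrans (probability_setC mu mD) _.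
  by rewrite muD.
rewrite iD iDC; change ((c * (expR t * v + (1 - v)))%:E <= 1%:E)%E.
rewrite lee_fin /c.
(* it remains to see that 1 + (e^t - 1) v <= exp (t v + 2 t^2 v) *)
rewrite -(ler_pM2l (expR_gt0 (- (- t * v - 2 * t ^+ 2 * v)))) mulrA -expRD addNr.
rewrite expR0 mul1r mulr1.
apply: le_trans (expR_ge1Dx _).
have := ler_wpM2r v0 (expR_le_quad t12); nra.
Qed.

(** Each index contributes two exponential weights, one for either direction of
    deviation.  The hypothesis says that the union bound over all of them is at
    most 1; every single weighted product is then at most 1 at the selected
    points, and taking logarithms gives the estimate. *)
Lemma exists_empirical_approx {R : realType} d (T : measurableType d)
    (mu : probability T R) (I : finType) (D : I -> set T) (m : nat)
    (lam : R) (tol : I -> R) :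
  (forall i, measurable (D i)) -> 0 < lam -> lam <= 1 / 2 ->
  \sum_i 2 * expR (- (2 * lam ^+ 2 * m%:R * tol i)) <= 1 ->
  exists z : nat -> T, forall i,
    `|\sum_(k < m) \1_(D i) (z k) - m%:R * fine (mu (D i))|
      <= 2 * lam * m%:R * (fine (mu (D i)) + tol i).
Proof.
move=> mD lam0 lam12 tol1.
pose sg (b : bool) : R := if b then lam else - lam.
have sg2 b : sg b ^+ 2 = lam ^+ 2 by case: b; rewrite /sg ?sqrrN.
pose v i := fine (mu (D i)).
pose G (ib : I * bool) (x : T) : R :=
  expR (sg ib.2 * (\1_(D ib.1) x - v ib.1) - 2 * sg ib.2 ^+ 2 * v ib.1).
pose w (ib : I * bool) := expR (- (2 * lam ^+ 2 * m%:R * tol ib.1)).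
have [||||z zle] := @exists_sample_sum_le R d T mu _ G m w.
- move=> [i b]; apply: measurableT_comp => //.
  apply: measurable_funB => //; apply: measurable_funM => //.
  by apply: measurable_funB => //; exact: measurable_indic.
- by move=> i x; exact: expR_ge0.
- move=> [i b]; apply: integral_expR_indic_le1 => //=.
    by rewrite fineK ?fin_num_measure.
  by rewrite /sg; case: b; lra.
- by move=> i; exact: expR_ge0.
exists z => i.
have key b : sg b * (\sum_(k < m) \1_(D i) (z k) - m%:R * v i)
    <= 2 * lam ^+ 2 * m%:R * (v i + tol i).
  have : w (i, b) * \prod_(k < m) G (i, b) (z k) <= 1.
    apply: le_trans tol1.
    have -> : \sum_i 2 * expR (- (2 * lam ^+ 2 * m%:R * tol i)) = \sum_ib w ib.
      rewrite -(pair_bigA _ (fun i b => w (i, b)))/=; apply: eq_bigr => j _.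
      by rewrite big_bool mulr_natl mulr2n.
    apply: le_trans zle; rewrite (bigD1 (i, b))//= lerDl.
    apply: sumr_ge0 => j _; rewrite mulr_ge0 ?expR_ge0//.
    by apply: prodr_ge0 => k _; exact: expR_ge0.
  rewrite /G -expR_sum -expRD -[leRHS]expR0 ler_expR/=.
  rewrite big_split/= -mulr_sumr big_split/= !sumrN !sumr_const card_ord sg2.
  rewrite -[v i *+ m]mulr_natl -[_ * v i *+ m]mulr_natl => h.
  rewrite -subr_le0; apply: le_trans h.
  by rewrite le_eqVlt; apply/orP; left; apply/eqP; ring.
have := key true; have := key false; rewrite /sg => h1 h2.
have e : 2 * lam ^+ 2 * m%:R * (v i + tol i) =
    lam * (2 * lam * m%:R * (v i + tol i)) by ring.
rewrite ler_norml -(ler_pM2l lam0) -[X in _ && X](ler_pM2l lam0) -!e mulrN -e.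
by rewrite -[X in X && _]lerN2 opprK -mulNr h1 h2.
Qed.

(** * Approximating |f|^p by a step function *)

Definition increment {R : zmodType} (U : nat -> R) (j : nat) : R :=
  U j - (if j is i.+1 then U i else 0).

Lemma sum_increment {R : zmodType} (U : nat -> R) (n : nat) :
  \sum_(j < n.+1) increment U j = U n.
Proof.
elim: n => [|n IH]; first by rewrite big_ord_recl big_ord0 /increment subr0 addr0.
by rewrite big_ord_recr/= IH /increment addrC subrK.
Qed.

(** Here [P] stands for a value of |f|^p, [U] for the geometric sequence of
    levels and [b j] for the outcome of an inexact test of whether [P] exceeds
    [U j].  Summing the increments over the positive tests recovers [P]. *)
Section staircase.
Context {R : realType} (U : nat -> R) (b : nat -> bool) (K P : R).
Hypotheses (K1 : 1 <= K) (U0 : 0 <= U 0%N) (US : forall j, U j.+1 = K * U j).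

Lemma staircase_ge0 j : 0 <= U j.
Proof. by elim: j => // j IH; rewrite US mulr_ge0// (le_trans _ K1). Qed.

Lemma staircase_homo i j : (i <= j)%N -> U i <= U j.
Proof.
elim: j => [|j IH]; first by rewrite leqn0 => /eqP ->.
rewrite leq_eqVlt => /predU1P[->//|/IH] /le_trans; apply.
by rewrite US ler_peMl// staircase_ge0.
Qed.

Lemma increment_ge0 j : 0 <= increment U j.
Proof.
by case: j => [|j]; rewrite /increment ?subr0// subr_ge0; exact: staircase_homo.
Qed.

(** Only the last positive test matters: up to it, the increments telescope. *)
Lemma staircase_le n : 0 <= P -> (forall j, (j < n)%N -> b j -> U j <= P) ->
  \sum_(j < n) increment U j * (b j)%:R <= P.
Proof.
move=> P0; elim: n => [|n IH] bU; first by rewrite big_ord0.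
rewrite big_ord_recr/=; have [bn|_] := boolP (b n); last first.
  rewrite mulr0 addr0; apply: IH => j /ltnW jn; exact: bU.
apply: le_trans (bU n (ltnSn n) bn).
rewrite mulr1 -[leRHS]sum_increment [leRHS]big_ord_recr/=.
rewrite lerD2r; apply: ler_sum => j _.
by rewrite ler_piMr ?increment_ge0//; case: (b j).
Qed.

(** All tests up to the last level below [P / K] are positive, and the level
    reached there is within [K ^+ 2] of [P]: one factor [K] for the inexactness
    of the test and one for the gap between consecutive levels.  The term
    [K * U 0] covers the values of [P] below the lowest level. *)
Lemma staircase_ge n : P <= K * U n ->
  (forall j, (j < n)%N -> K * U j <= P -> b j) ->
  P <= K ^+ 2 * (\sum_(j < n) increment U j * (b j)%:R) + K * U 0.
Proof.
have K0 : 0 <= K by rewrite (le_trans _ K1).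
elim: n => [|n IH] PU bU; first by rewrite big_ord0 mulr0 add0r.
have [PUn|UnP] := leP P (K * U n).
  apply: (le_trans (IH PUn _)) => [j /ltnW|]; first exact: bU.
  rewrite lerD2r ler_wpM2l ?exprn_ge0// big_ord_recr/= lerDl mulr_ge0//.
  exact: increment_ge0.
have -> : \sum_(j < n.+1) increment U j * (b j)%:R = U n.
  rewrite -[RHS]sum_increment; apply: eq_bigr => j _.
  rewrite bU ?mulr1// (le_trans _ (ltW UnP))// ler_wpM2l//.
  by apply: staircase_homo; rewrite -ltnS.
by apply: (le_trans PU); rewrite US mulrA -expr2 lerDl mulr_ge0.
Qed.

End staircase.

(** Young's inequality with second factor 1.  Integrated against a probability
    measure, it turns a bound by 1 on the integral of |f|^p into the same bound
    for |f|^q. *)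
Lemma powR_le_affine {R : realType} (q p t : R) : 0 < q -> q <= p -> 0 <= t ->
  t `^ q <= (1 - q / p) + (q / p) * t `^ p.
Proof.
move=> q0 qp t0; have p0 : 0 < p := lt_le_trans q0 qp.
have [->|neq] := eqVneq q p; first by rewrite mulfV ?gt_eqF// subrr add0r mul1r.
have qltp : q < p by rewrite lt_neqAle neq.
have d0 : 0 < 1 - q / p by rewrite subr_gt0 ltr_pdivrMr// mul1r.
have := @conjugate_powR R (t `^ q) 1 (p / q) (1 - q / p)^-1
  (powR_ge0 _ _) ler01 (divr_gt0 p0 q0).
rewrite invr_gt0 invrK invf_div => /(_ d0).
rewrite [q / p + _]addrC subrK mulr1 powR1 mul1r -powRrM [q * _]mulrC.
rewrite divfK ?gt_eqF//.
by move=> /(_ erefl); rewrite mulrC addrC.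
Qed.

(** The radius makes [`|y|] a reliable test of the level of [`|v|]: with
    c = K^(1/p) and u = U^(1/p), an error of (1 - 1/c) u can push neither
    [`|y| >= u] below [`|v| = u / c] nor [`|v| >= c * u] below [`|y| = u], the
    latter because c + 1/c >= 2. *)
Lemma level_compare {R : realType} (p K U v y : R) :
  0 < p -> 1 <= K -> 0 < U ->
  `|v - y| <= (1 - (K `^ p^-1)^-1) * U `^ p^-1 ->
  (U `^ p^-1 <= `|y| -> U <= K * `|v| `^ p) /\
  (K * U <= `|v| `^ p -> U `^ p^-1 <= `|y|).
Proof.
move=> p0 K1 U0; set c := K `^ p^-1; set u := U `^ p^-1 => vy.
have pK t : 0 <= t -> (t `^ p^-1) `^ p = t.
  by move=> t0; rewrite -powRrM mulVf ?gt_eqF// powRr1.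
have K0 : 0 < K := lt_le_trans ltr01 K1.
have c0 : 0 < c by exact: powR_gt0.
have c1 : 1 <= c by rewrite /c -(powRr0 K) ler_powR// invr_ge0 ltW.
have u0 : 0 < u by exact: powR_gt0.
have cV : c^-1 * c = 1 by rewrite mulVf// gt_eqF.
have vy1 := ler_normB v (v - y); have vy2 := ler_normD (v - y) y.
rewrite opprB addrC subrK in vy1; rewrite subrK in vy2.
split=> [uy|KU].
  have uv : u <= c * `|v|.
    have : c^-1 * u <= `|v| by lra.
    by move=> /(ler_wpM2l (ltW c0)); rewrite mulrA divff ?gt_eqF// mul1r.
  rewrite -(pK U) ?(ltW U0)// -(pK K) ?(ltW K0)//.
  rewrite -powRM ?normr_ge0//; last exact: ltW.
  by apply: ge0_ler_powR => //; rewrite ?nnegrE ?mulr_ge0// ltW.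
have cuv : c * u <= `|v|.
  have -> : `|v| = (`|v| `^ p) `^ p^-1.
    by rewrite -powRrM mulfV ?gt_eqF// powRr1.
  rewrite /c /u -powRM ?(ltW K0) ?(ltW U0)//.
  apply: ge0_ler_powR => //; rewrite ?nnegrE ?mulr_ge0 ?powR_ge0 ?invr_ge0 ?ltW//.
have : 2 <= c + c^-1.
  have : 0 <= (c - 1) ^+ 2 * c^-1 by rewrite mulr_ge0 ?sqr_ge0// invr_ge0 ltW.
  by nra.
move=> /(ler_wpM2r (ltW u0)); nra.
Qed.

(** * Discretization of functions of unit norm *)

Lemma mean_eq_level_sum {R : realType} (m n : nat) (w : nat -> R)
    (b : nat -> nat -> R) :
  m%:R^-1 * \sum_(k < m) \sum_(j < n) w j * b j k =
  \sum_(j < n) w j * (m%:R^-1 * \sum_(k < m) b j k).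
Proof.
rewrite exchange_big/= mulr_sumr; apply: eq_bigr => j _.
by rewrite -mulr_sumr mulrCA.
Qed.

(** [E] and 1 are the sample mean and the integral of |f|^p, [EH] and [S] those
    of its step approximation.  The level ratio 21/20, the lowest level 1/20 and
    the sampling error 1/20 are small enough for the final factors 1/2 and 3/2. *)
Lemma mean_bounds {R : realType} (E EH S : R) :
  EH <= 21 / 20 * E -> E <= (21 / 20) ^+ 2 * EH + 21 / 20 * 20^-1 ->
  1 <= (21 / 20) ^+ 2 * S + 21 / 20 * 20^-1 -> S <= 21 / 20 ->
  `|EH - S| <= 20^-1 * (S + 1) -> 1 / 2 <= E <= 3 / 2.
Proof.
move=> h1 h2 h3 h4; rewrite ler_norml => /andP[h5 h6].
by apply/andP; split; lra.
Qed.

(** The probabilistic core, with the entropy hypothesis already turned into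
    nets.  [A] is the class to be discretized, [X] the space from which the net
    elements come, [n] the number of levels. *)
Section normalized_discretization.
Context {R : realType} {d} {T : measurableType d} (mu : probability T R).
Variables (p V : R) (X A : set (T -> R)) (n m : nat).

Let K : R := 21 / 20.
Let U (j : nat) : R := 20^-1 * K ^+ j.
Let a : R := 1 - (K `^ p^-1)^-1.
Let W : R := (2 * V / a) `^ p.

Hypotheses (p1 : 1 <= p) (V1 : 1 <= V).
Hypothesis XM : forall f, X f -> measurable_fun setT f.
Hypothesis AX : A `<=` X.
Hypothesis bounded_A : forall f, A f -> forall x, `|f x| <= 2 * V.
Hypothesis net_A : forall r, 0 < r ->
  exists (k : nat) (y : 'I_(2 ^ k) -> T -> R),
    [/\ k%:R <= 1 + (2 * V / r) `^ p, forall i, X (y i)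
      & forall f, A f -> exists i, forall x, `|f x - y i x| <= r].
Hypotheses (n_gt0 : (0 < n)%N) (top_level : (2 * V) `^ p <= K * U n).
Hypothesis levels : forall j, (j < n)%N -> U j <= (2 * V) `^ p.
Hypothesis m_large : n%:R * ((n%:R + 3) * W) <= 2 * 40^-1 ^+ 2 * m%:R.

Let p0 : 0 < p. Proof. exact: lt_le_trans ltr01 p1. Qed.
Let K1 : 1 <= K. Proof. by rewrite /K; lra. Qed.
Let U_gt0 j : 0 < U j. Proof. by rewrite mulr_gt0// exprn_gt0// /K; lra. Qed.
Let US j : U j.+1 = K * U j. Proof. by rewrite /U exprS mulrCA. Qed.

Let a01 : 0 < a <= 1.
Proof.
have K0 : 0 < K by rewrite /K; lra.
rewrite /a; set c := K `^ p^-1.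
have c1 : 1 < c.
  rewrite /c -(powRr0 K) /powR !gt_eqF// ltr_expR mul0r.
  by rewrite mulr_gt0 ?invr_gt0// ln_gt0// /K; lra.
have c0 : 0 < c by exact: lt_trans c1.
by rewrite subr_gt0 invf_lt1// c1 gerBl invr_ge0 ltW.
Qed.

Let W_ge : (2 * V) `^ p <= W.
Proof.
have /andP[a0 a1] := a01.
have V0 : 0 <= V by rewrite (le_trans _ V1).
apply: ge0_ler_powR; rewrite ?nnegrE ?divr_ge0 ?mulr_ge0// ?(ltW p0) ?(ltW a0)//.
by rewrite ler_pdivlMr// ler_piMr// mulr_ge0.
Qed.

Let W_ge1 : 1 <= W.
Proof.
apply: le_trans W_ge; rewrite -[leLHS](powRr0 (2 * V)) ler_powR//; last exact: ltW.
by have := V1; lra.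
Qed.

Let m_gt0 : (0 < m)%N.
Proof.
rewrite lt0n; apply/eqP => m0; move: m_large; rewrite m0 mulr0 leNgt => /negP.
apply; apply: mulr_gt0; first by rewrite ltr0n.
by apply: mulr_gt0; [rewrite addr_gt0 ?ltr0n|exact: lt_le_trans ltr01 W_ge1].
Qed.

Let mean1 : \sum_(j < n) n%:R^-1 = 1 :> R.
Proof.
by rewrite sumr_const card_ord -[_ *+ n]mulr_natl mulfV// pnatr_eq0 -lt0n.
Qed.

(** The failure probability of one level, 2^k sets with tolerance
    1 / (n U_j) each, is at most 1/n.  A finer net is needed at a lower level,
    but the tolerance is larger there in the same proportion: [U j * k] is of
    order [W] at every level. *)
Let failure_le j k : (j < n)%N -> k%:R <= 1 + (2 * V / (a * U j `^ p^-1)) `^ p ->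
  n%:R * (2 ^+ k *
    (2 * expR (- (2 * 40^-1 ^+ 2 * m%:R * (n%:R * U j)^-1)))) <= 1 :> R.
Proof.
move=> jn kle; have /andP[a0 a1] := a01.
have V0 : 0 <= V by rewrite (le_trans _ V1).
have Uk : U j * k%:R <= U j + W.
  have -> : U j + W = U j * (1 + (2 * V / (a * U j `^ p^-1)) `^ p).
    have -> : 2 * V / (a * U j `^ p^-1) = 2 * V / a * (U j `^ p^-1) `^ (-1).
      by rewrite powR_inv1 ?powR_ge0// invfM mulrA.
    have Z0 : 0 <= 2 * V / a by rewrite divr_ge0 ?mulr_ge0 ?(ltW a0).
    rewrite mulrDr mulr1 powRM ?powR_ge0// powRAC.
    rewrite -(powRrM _ p^-1) mulVf ?gt_eqF// powRr1 ?(ltW (U_gt0 j))//.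
    by rewrite powR_inv1 ?(ltW (U_gt0 j))// mulrCA mulfV ?gt_eqF// mulr1.
  by rewrite ler_wpM2l// ltW.
have UW : U j <= W := le_trans (levels jn) W_ge.
have nk : n%:R + k%:R + 1 <= 2 * 40^-1 ^+ 2 * m%:R * (n%:R * U j)^-1 :> R.
  have nU : 0 < n%:R * U j by rewrite mulr_gt0// ltr0n.
  rewrite ler_pdivlMr//.
  have -> : (n%:R + k%:R + 1) * (n%:R * U j) =
      n%:R * (U j * n%:R + U j * k%:R + U j) by ring.
  have : n%:R * (U j * n%:R + U j * k%:R + U j) <= n%:R * ((n%:R + 3) * W).
    rewrite ler_wpM2l// (_ : (n%:R + 3) * W = W * n%:R + (W + W) + W); last by ring.
    by rewrite !lerD// ?ler_wpM2r// (le_trans Uk)// lerD.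
  by move/le_trans; apply.
(* bound each of the factors n, 2^k and 2 by the exponential of its exponent *)
have e1 : 2 <= expR 1 :> R by apply: le_trans (expR_ge1Dx _); lra.
have en : n%:R <= expR n%:R :> R.
  by apply: le_trans (expR_ge1Dx _); rewrite lerDr.
have ek : 2 ^+ k <= expR k%:R :> R.
  by rewrite -[k%:R]mulr1 expRM_natl lerXn2r// ?nnegrE ?expR_ge0.
rewrite expRN mulrA mulrA ler_pdivrMr ?expR_gt0// mul1r.
apply: le_trans (_ : expR (n%:R + k%:R + 1) <= _); last by rewrite ler_expR.
rewrite !expRD ler_pM// ?mulr_ge0 ?exprn_ge0//.
by rewrite ler_pM// exprn_ge0.
Qed.

Theorem normalized_discretization :
  exists z : nat -> T, forall f, A f ->
    (\int[mu]_x (`|f x| `^ p)%:E = 1)%E ->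
    1 / 2 <= m%:R^-1 * \sum_(k < m) `|f (z k)| `^ p <= 3 / 2.
Proof.
have /andP[a0 a1] := a01.
have /all_sig [k /(_ _)/cid hk] : forall j,
  {k : nat | exists y : 'I_(2 ^ k) -> T -> R,
    [/\ k%:R <= 1 + (2 * V / (a * U j `^ p^-1)) `^ p, forall i, X (y i)
      & forall f, A f -> exists i, forall x, `|f x - y i x| <= a * U j `^ p^-1]}.
  by move=> j; apply: cid; apply: net_A; rewrite mulr_gt0// powR_gt0.
pose y j := sval (hk j).
have yP j : [/\ (k j)%:R <= 1 + (2 * V / (a * U j `^ p^-1)) `^ p,
    forall i, X (y j i)
  & forall f, A f -> exists i, forall x, `|f x - y j i x| <= a * U j `^ p^-1].
  by rewrite /y; case: (hk j).
(* the sets to be sampled: a level together with an element of its net *)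
pose I : finType := {j : 'I_n & 'I_(2 ^ k j)}.
pose D (i : I) : set T := [set x | U (tag i) `^ p^-1 <= `|y (tag i) (tagged i) x|].
pose tol (i : I) : R := (n%:R * U (tag i))^-1.
have mD i : measurable (D i).
  have my : measurable_fun setT (fun x => `|y (tag i) (tagged i) x|).
    by apply: measurableT_comp => //; apply: XM; case: (yP (tag i)).
  have := my measurableT _ (measurable_itv `[U (tag i) `^ p^-1, +oo[).
  rewrite setTI; congr (measurable _); apply/seteqP.
  by split=> x /=; rewrite in_itv/= andbT.
have sum_le1 : \sum_i 2 * expR (- (2 * 40^-1 ^+ 2 * m%:R * tol i)) <= 1.
  pose F (j : 'I_n) (i : 'I_(2 ^ k j)) : R :=
    2 * expR (- (2 * 40^-1 ^+ 2 * m%:R * (n%:R * U j)^-1)).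
  have -> : \sum_i 2 * expR (- (2 * 40^-1 ^+ 2 * m%:R * tol i)) =
      \sum_(i : I) F (tag i) (tagged i) by [].
  rewrite -(sig_big_dep xpredT (fun=> xpredT) F)/=.
  apply: le_trans (_ : \sum_(j < n) n%:R^-1 <= _); last first.
    by rewrite mean1.
  apply: ler_sum => j _; rewrite sumr_const card_ord -[_ *+ _]mulr_natl natrX.
  rewrite -(ler_pM2l (_ : 0 < n%:R :> R)) ?ltr0n// mulfV ?pnatr_eq0 -?lt0n//.
  by apply: failure_le => //; case: (yP j).
have lam0 : 0 < 40^-1 :> R by lra.
have lam12 : 40^-1 <= 1 / 2 :> R by lra.
have [z zP] := exists_empirical_approx mu mD lam0 lam12 sum_le1.
exists z => f Af f1.
have /all_sig[i iP] : forall j, {i : 'I_(2 ^ k j) |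
    forall x, `|f x - y j i x| <= a * U j `^ p^-1}.
  by move=> j; apply: cid; case: (yP j) => _ _; exact.
(* the step function attached to f by the net elements chosen near it *)
pose b j x := U j `^ p^-1 <= `|y j (i j) x|.
pose H x : R := \sum_(j < n) increment U j * (b j x)%:R.
have lower x : H x <= K * `|f x| `^ p.
  apply: (@staircase_le R U (b^~ x) K _ K1 (ltW (U_gt0 0)) US n).
    by rewrite mulr_ge0 ?powR_ge0// (le_trans _ K1).
  by move=> j _; apply: (level_compare p0 K1 (U_gt0 j) (iP j x)).1.
have upper x : `|f x| `^ p <= K ^+ 2 * H x + K * U 0%N.
  apply: (@staircase_ge R U (b^~ x) K _ K1 (ltW (U_gt0 0)) US n).
    apply: le_trans top_level; apply: ge0_ler_powR => //; first exact: ltW.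
    - by rewrite nnegrE mulr_ge0// (le_trans _ V1).
    - exact: bounded_A.
  by move=> j _; apply: (level_compare p0 K1 (U_gt0 j) (iP j x)).2.
pose Dj j := [set x | b j x].
pose v j := fine (mu (Dj j)).
have mDj (j : 'I_n) : measurable (Dj j) :=
  mD (Tagged (fun j : 'I_n => 'I_(2 ^ k j)) (i j) : I).
have Hindic x : H x = \sum_(j < n) increment U j * \1_(Dj j) x.
  apply: eq_bigr => j _; rewrite indicE; congr (_ * _%:R).
  rewrite /Dj; case: (boolP (b j x)) => bjx; first by rewrite mem_set.
  by rewrite memNset//; exact/negP.
have inc0 j : 0 <= increment U j.
  exact: (increment_ge0 K1 (ltW (U_gt0 0)) US).
pose S : R := \sum_(j < n) increment U j * v j.
have mH : measurable_fun setT H.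
  rewrite (_ : H = fun x => \sum_(j < n) increment U j * \1_(Dj j) x).
    apply: measurable_sum => j; exact: measurable_funM.
  exact/funext.
have H0 x : 0 <= H x by apply: sumr_ge0 => j _; rewrite mulr_ge0.
have mf : measurable_fun setT (fun x => `|f x| `^ p).
  by apply: measurable_norm_powR; apply: XM; exact: AX.
have intH : (\int[mu]_x (H x)%:E = S%:E)%E.
  under eq_integral do rewrite Hindic -sumEFin.
  rewrite ge0_integral_sum//; last 2 first.
  - move=> j; apply/measurable_EFinP/measurable_funM => //.
  - by move=> j x _; rewrite lee_fin mulr_ge0.
  rewrite /S -sumEFin; apply: eq_bigr => j _.
  by rewrite ge0_integral_EFinZl// integral_EFin_indic// EFinM.
have SK : S <= K.
  rewrite -lee_fin -intH -[K%:E]mule1 -f1.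
  rewrite -ge0_integral_EFinZl//; last exact: (le_trans ler01 K1).
  by apply: ge0_le_integral_EFin => //; exact: measurable_funM.
have KS : 1 <= K ^+ 2 * S + K * U 0%N.
  rewrite -lee_fin -f1 EFinD EFinM -intH.
  rewrite -ge0_integral_EFinZl ?exprn_ge0 ?(le_trans ler01 K1)//.
  have -> : ((K * U 0%N)%:E = \int[mu]_x (K * U 0%N)%:E)%E.
    by rewrite integral_probability_cst.
  have KU0 : 0 <= K * U 0%N by rewrite mulr_ge0 ?(ltW (U_gt0 _))// (le_trans _ K1).
  rewrite -ge0_integralD//=; last 2 first.
  - by move=> x _; rewrite lee_fin mulr_ge0 ?exprn_ge0 ?(le_trans ler01 K1).
  - by apply/measurable_EFinP/measurable_funM.
  under [leRHS]eq_integral do rewrite -EFinD.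
  apply: ge0_le_integral_EFin => //.
  by apply: measurable_funD => //; exact: measurable_funM.
pose E : R := m%:R^-1 * \sum_(k < m) `|f (z k)| `^ p; rewrite -/E.
pose EH : R := m%:R^-1 * \sum_(k < m) H (z k).
have m0 : 0 < m%:R^-1 :> R by rewrite invr_gt0 ltr0n.
have mV : m%:R^-1 * m%:R = 1 :> R by rewrite mulVf// pnatr_eq0 -lt0n.
have EHE : EH <= K * E.
  rewrite /EH /E [K * _]mulrCA ler_pM2l// mulr_sumr; exact: ler_sum.
have EEH : E <= K ^+ 2 * EH + K * U 0%N.
  have -> : K ^+ 2 * EH + K * U 0%N =
      m%:R^-1 * \sum_(k < m) (K ^+ 2 * H (z k) + K * U 0%N).
    rewrite big_split/= -mulr_sumr sumr_const card_ord -[(K * U 0%N) *+ m]mulr_natl.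
    by rewrite mulrDr [m%:R^-1 * (m%:R * _)]mulrA mV mul1r [m%:R^-1 * _]mulrCA.
  by rewrite ler_pM2l//; exact: ler_sum.
(* the tolerances were chosen so that increment U j * t_j <= 1 / n *)
have EHS : `|EH - S| <= 20^-1 * (S + 1).
  have -> : EH = \sum_(j < n) increment U j *
      (m%:R^-1 * \sum_(k < m) \1_(Dj j) (z k)).
    rewrite -(mean_eq_level_sum m n _ (fun j k => \1_(Dj j) (z k))).
    by congr (_ * _); apply: eq_bigr => l _; exact: Hindic.
  rewrite -[X in S + X]mean1 /S -sumrB; apply: le_trans (ler_norm_sum _ _ _) _.
  rewrite -big_split/= mulr_sumr; apply: ler_sum => j _.
  rewrite -mulrBr normrM (ger0_norm (inc0 j)).
  have := zP (Tagged (fun j : 'I_n => 'I_(2 ^ k j)) (i j)).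
  rewrite /= -/(v j) /tol/=.
  have -> : D (Tagged (fun j : 'I_n => 'I_(2 ^ k j)) (i j)) = Dj j by [].
  rewrite -/(v j) => /(ler_wpM2l (ltW m0)).
  have -> : m%:R^-1 * `|\sum_(k1 < m) \1_(Dj j) (z k1) - m%:R * v j| =
     `|m%:R^-1 * \sum_(k1 < m) \1_(Dj j) (z k1) - v j|.
    by rewrite -[X in X * _](ger0_norm (ltW m0)) -normrM mulrBr mulrA mV mul1r.
  move=> /(ler_wpM2l (inc0 j)) /le_trans; apply.
  have -> : increment U j *
      (m%:R^-1 * (2 * 40^-1 * m%:R * (v j + (n%:R * U j)^-1))) =
    (m%:R^-1 * m%:R) * (20^-1 *
      (increment U j * v j + increment U j * (n%:R * U j)^-1)).
    by rewrite (_ : 20^-1 = 2 * 40^-1 :> R); [ring|lra].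
  rewrite mV mul1r ler_wpM2l// lerD2l.
  have incU : increment U j <= U j.
    by rewrite /increment; case: (nat_of_ord j) => [|j']; rewrite ?subr0// gerBl ltW.
  rewrite invfM mulrCA ler_piMr ?invr_ge0// ler_pdivrMr// mul1r.
  exact: incU.
apply: (mean_bounds EHE _ _ SK EHS); first by move: EEH; rewrite /U expr0 mulr1.
by move: KS; rewrite /U expr0 mulr1.
Qed.

End normalized_discretization.

(** * From entropy numbers to nets *)

Lemma entropy_net {R : realType} {V : zmodType} (norm : V -> \bar R)
    (A : set V) (k : nat) (r : R) : (entropy_number norm A k < r%:E)%E ->
  exists y : 'I_(2 ^ k) -> V, (forall j, A (y j)) /\
    forall f, A f -> exists j, (norm (f - y j)%R <= r%:E)%E.
Proof.
move=> /ereal_inf_lt [_ [e [e0 [y [Ay sub]]] <-] er].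
exists y; split=> // f /sub [j _ /= fy]; exists j.
exact: le_trans fy (ltW er).
Qed.

Lemma uniform_norm_le {R : realType} {T : Type} (f : T -> R) (r : R) :
  (uniform_norm f <= r%:E)%E -> forall x, `|f x| <= r.
Proof.
move=> fr x; rewrite -lee_fin; apply: le_trans fr.
by apply: ereal_sup_ubound; exists x.
Qed.

Lemma Lnorm_le1 {R : realType} d (T : measurableType d) (mu : probability T R)
    (q : R) (f : T -> R) : 0 < q -> (\int[mu]_x (`|f x| `^ q)%:E <= 1)%E ->
  ('N[mu]_q%:E[EFin \o f] <= 1)%E.
Proof.
move=> q0 fq; rewrite unlock -(poweR1r q^-1); apply: gt0_ler_poweR => //.
- by rewrite invr_ge0 ltW.
- rewrite in_itv/= leey andbT; apply: integral_ge0 => x _.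
  by rewrite lee_fin powR_ge0.
- by rewrite in_itv/= leey andbT.
Qed.

Section entropy_to_nets.
Context {R : realType} {d} {T : measurableType d} (mu : probability T R).
Variables (q B : R) (N : nat) (X : set (T -> R)).
Let V : R := B * N%:R `^ q^-1.
Let A : set (T -> R) := [set f | X f /\ (\int[mu]_x (`|f x| `^ q)%:E <= 1)%E].

Hypotheses (q1 : 1 <= q) (N_gt0 : (0 < N)%N) (B1 : 1 <= B).
Hypothesis XM : forall f, X f -> measurable_fun setT f.
Hypothesis XZ : forall (c : R) f, X f -> X (fun x => c * f x).
Hypothesis entropyX : forall k, (0 < k)%N ->
  (entropy_number uniform_norm (Lnorm_ball mu q X) k
   <= (B * (N%:R / k%:R) `^ (1 / q))%:E)%E.

Let q0 : 0 < q. Proof. exact: lt_le_trans ltr01 q1. Qed.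
Let B0 : 0 < B. Proof. exact: lt_le_trans ltr01 B1. Qed.

Let one_powR : 1 `^ q = 1 :> R. Proof. by rewrite powR1. Qed.

Lemma scale_ge1 : 1 <= V.
Proof.
rewrite /V -[leLHS]mulr1; apply: ler_pM => //.
by rewrite -[leLHS](powRr0 N%:R) ler_powR// ?invr_ge0 ?(ltW q0)// ler1n.
Qed.

Let V0 : 0 < V. Proof. exact: lt_le_trans ltr01 scale_ge1. Qed.

Lemma scaled_ball_mem (c : R) f : `|c| <= 1 -> A f -> A (fun x => c * f x).
Proof.
move=> c1 [Xf f1]; split; first exact: XZ.
apply: le_trans f1; apply: ge0_le_integral_EFin.
- by apply: measurable_norm_powR; apply: measurable_funM => //; exact: XM.
- by apply: measurable_norm_powR; exact: XM.
- by move=> x; exact: powR_ge0.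
- move=> x; apply: ge0_ler_powR; rewrite ?nnegrE ?(ltW q0)//.
  by rewrite normrM ler_piMl.
Qed.

(** The strict inequality on [k] leaves the room needed to pass from the infimum
    that defines the entropy number to an actual covering. *)
Lemma net_of_entropy k r : (0 < k)%N -> 0 < r -> (V / r) `^ q < k%:R ->
  exists y : 'I_(2 ^ k) -> T -> R, (forall i, X (y i)) /\
    forall f, A f -> exists i, forall x, `|f x - y i x| <= r.
Proof.
move=> k0 r0 kV; have k0' : 0 < k%:R :> R by rewrite ltr0n.
have lt_r : B * (N%:R / k%:R) `^ (1 / q) < r.
  rewrite div1r powRM ?invr_ge0// mulrA -/V.
  have kq : V / r < k%:R `^ q^-1.
    have := @gt0_ltr_powR R q^-1; rewrite invr_gt0 => /(_ q0 ((V / r) `^ q) k%:R).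
    rewrite !nnegrE powR_ge0 ler0n => /(_ isT isT kV).
    by rewrite -powRrM mulfV ?gt_eqF// powRr1// divr_ge0// ltW.
  rewrite -[k%:R^-1]powR_inv1// powRAC powR_inv1 ?powR_ge0//.
  by rewrite ltr_pdivrMr ?powR_gt0// mulrC -ltr_pdivrMr.
have : (entropy_number uniform_norm (Lnorm_ball mu q X) k < r%:E)%E.
  by apply: le_lt_trans (entropyX k0) _; rewrite lte_fin.
move=> /entropy_net [y [Ay net]]; exists y; split=> [i|f [Xf f1]].
  by case: (Ay i).
have [|i fy] := net f; first by split=> //; exact: Lnorm_le1.
by exists i => x; exact: (uniform_norm_le fy).
Qed.

(** The two balls provided by the first entropy number cover the three functions
    f, -f and 0; two of these share a ball, so |f| is at most its diameter. *)
Lemma ball_bounded f : A f -> forall x, `|f x| <= 2 * V.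
Proof.
move=> Af x; apply/ler_addgt0Pr => e e0.
have [|||y [Xy net]] := @net_of_entropy 1 (V + e / 2).
- by [].
- by rewrite addr_gt0// divr_gt0.
- have Ve : 0 < V + e / 2 by rewrite addr_gt0// divr_gt0.
  rewrite -[ltRHS]one_powR; apply: gt0_ltr_powR => //; rewrite ?nnegrE//.
    by rewrite divr_ge0// ltW.
  by rewrite ltr_pdivrMr// mul1r ltrDl divr_gt0.
have Ac c : `|c| <= 1 -> exists i : 'I_2, `|c * f x - y i x| <= V + e / 2.
  by move=> c1; have [i iP] := net _ (scaled_ball_mem c1 Af); exists i; exact: iP.
have [|i1 h1] := Ac 1; first by rewrite normr1.
have [|i2 h2] := Ac (-1); first by rewrite normrN1.
have [|i3 h3] := Ac 0; first by rewrite normr0.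
have pigeon : [|| i1 == i2, i1 == i3 | i2 == i3].
  by move: i1 i2 i3 {h1 h2 h3} => [[|[|?]] ?] [[|[|?]] ?] [[|[|?]] ?].
move: h1 h2 h3; rewrite !ler_norml => /andP[? ?] /andP[? ?] /andP[? ?].
by case/or3P: pigeon => /eqP ij; subst; apply/andP; split; lra.
Qed.

(** Weakening the exponent q to [p] and the scale V to 2V costs nothing later
    and makes the size of the net match the bound on |f|.  For r > 2V the power
    with exponent [p] may be the smaller one, but then k = 1 is enough. *)
Lemma net_of_radius p r : q <= p -> 0 < r ->
  exists (k : nat) (y : 'I_(2 ^ k) -> T -> R),
    [/\ k%:R <= 1 + (2 * V / r) `^ p, forall i, X (y i)
      & forall f, A f -> exists i, forall x, `|f x - y i x| <= r].
Proof.
move=> qp r0; pose t := Num.trunc ((V / r) `^ q).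
have [|||y [Xy net]] := @net_of_entropy t.+1 r => //; first exact: truncnS_gt.
exists t.+1, y; split=> //; rewrite -addn1 natrD addrC lerD2l.
have Vr : 0 <= V / r by rewrite divr_ge0 ?ltW.
have Vr2 : V / r <= 2 * V / r by rewrite -mulrA ler_peMl// ler1n.
have [r_le|r_gt] := leP r (2 * V).
  apply: le_trans (_ : (V / r) `^ q <= _); first by rewrite truncn_le powR_ge0.
  apply: le_trans (_ : (2 * V / r) `^ q <= _).
    by apply: ge0_ler_powR; rewrite ?nnegrE ?(ltW q0)// (le_trans Vr).
  by rewrite ler_powR// ler_pdivlMr// mul1r.
rewrite (_ : t = 0%N) ?powR_ge0//; apply: truncn_def; rewrite powR_ge0/=.
rewrite -[ltRHS]one_powR; apply: gt0_ltr_powR => //; rewrite ?nnegrE//.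
by rewrite (le_lt_trans Vr2)// ltr_pdivrMr// mul1r.
Qed.

End entropy_to_nets.

(** * Discretization on one factor *)

Lemma exists_level_count {R : realType} (K Y : R) : 1 < K -> 1 <= Y ->
  exists n : nat, [/\ (0 < n)%N, Y <= K * (20^-1 * K ^+ n),
    forall j, (j < n)%N -> 20^-1 * K ^+ j <= Y
    & n%:R <= 1 + ln (20 * Y) / ln K].
Proof.
move=> K1 Y1; set x := ln (20 * Y) / ln K.
have K0 : 0 < K by exact: lt_trans ltr01 K1.
have lnK0 : 0 < ln K by exact: ln_gt0.
have Y20 : 1 <= 20 * Y by lra.
have x0 : 0 <= x by rewrite divr_ge0 ?(ltW lnK0) ?ln_ge0.
have xlnK : x * ln K = ln (20 * Y) by rewrite divfK ?gt_eqF.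
have KX j : K ^+ j = expR (j%:R * ln K) by rewrite expRM_natl lnK// posrE.
have YE : 20 * Y = expR (ln (20 * Y)) by rewrite lnK// posrE; lra.
exists (Num.trunc x).+1; split=> //.
- have : 20 * Y <= K ^+ (Num.trunc x).+1.
    rewrite YE KX ler_expR -xlnK ler_pM2r//; exact/ltW/truncnS_gt.
  move: (K ^+ _) => Z YZ.
  have : Z <= K * Z by rewrite ler_peMl ?(ltW K1)//; lra.
  lra.
- move=> j; rewrite ltnS => jx; suff : K ^+ j <= 20 * Y by lra.
  rewrite YE KX ler_expR -xlnK ler_pM2r//.
  by apply: le_trans (_ : (Num.trunc x)%:R <= _); rewrite ?ler_nat ?truncn_le.
by rewrite -addn1 natrD addrC lerD2l truncn_le.
Qed.

(** Both sides are homogeneous of degree p, so only the degenerate case of a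
    vanishing integral has to be assumed separately. *)
Lemma homogeneous_extension {R : realType} d (T : measurableType d)
    (mu : probability T R) (p : R) (m : nat) (z : 'I_m -> T)
    (X : set (T -> R)) (f : T -> R) : 0 < p ->
  (forall f, X f -> measurable_fun setT f) ->
  (forall (c : R) f, X f -> X (fun x => c * f x)) ->
  (forall f, X f -> (\int[mu]_x (`|f x| `^ p)%:E = 0)%E -> forall x, f x = 0) ->
  (forall f, X f -> (\int[mu]_x (`|f x| `^ p)%:E = 1)%E ->
    1 / 2 <= m%:R^-1 * \sum_(k < m) `|f (z k)| `^ p <= 3 / 2) ->
  X f -> (\int[mu]_x (`|f x| `^ p)%:E < +oo)%E ->
  ((1 / 2)%:E * \int[mu]_x (`|f x| `^ p)%:E
     <= (m%:R^-1 * \sum_(k < m) `|f (z k)| `^ p)%:E)%E /\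
  ((m%:R^-1 * \sum_(k < m) `|f (z k)| `^ p)%:E
     <= (3 / 2)%:E * \int[mu]_x (`|f x| `^ p)%:E)%E.
Proof.
move=> p0 XM XZ zeroX unitX Xf.
have mf g : X g -> measurable_fun setT (fun x => `|g x| `^ p).
  by move=> Xg; apply: measurable_norm_powR; exact: XM.
set Int := (\int[mu]_x _)%E => Ifin.
have I0 : (0 <= Int)%E by apply: integral_ge0 => x _; rewrite lee_fin powR_ge0.
have : Int \is a fin_num by rewrite ge0_fin_numE.
move: Int I0 Ifin (erefl : Int = \int[mu]_x (`|f x| `^ p)%:E)%E.
move=> [c| |]// c0 _ Ic _; rewrite lee_fin in c0.
have [ceq|cneq] := eqVneq c 0.
  have f0 : forall x, f x = 0 by apply: zeroX => //; rewrite -Ic ceq.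
  rewrite big1 ?ceq ?mulr0 ?mule0//.
  by move=> k _; rewrite f0 normr0 powR0// gt_eqF.
have cpos : 0 < c by rewrite lt_neqAle eq_sym cneq.
pose s := (c `^ p^-1)^-1.
have s0 : 0 <= s by rewrite invr_ge0 powR_ge0.
have spE : s `^ p = c^-1.
  rewrite /s -powR_inv1 ?powR_ge0// powRAC -(powRrM _ p^-1) mulVf ?gt_eqF//.
  by rewrite powRr1// powR_inv1.
have sfE x : `|s * f x| `^ p = c^-1 * `|f x| `^ p.
  by rewrite normrM powRM// (ger0_norm s0) spE.
have := unitX _ (XZ s _ Xf).
under eq_integral do rewrite sfE.
rewrite ge0_integral_EFinZl ?invr_ge0//; last exact: mf.
rewrite -Ic -EFinM mulVf// => /(_ erefl).
under eq_bigr do rewrite sfE.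
rewrite -mulr_sumr mulrCA !lee_fin => /andP[].
by rewrite ler_pdivlMl// ler_pdivrMl// [c * _]mulrC [c * (3 / 2)]mulrC => -> ->.
Qed.

(** Combines the preceding results with n = O(log (2BN)) levels.  The constant
    is 1 + D c^2 (2/a)^p, where n + 3 <= c log (2BN), D is the inverse of the
    factor of m in the Chernoff exponent, and the summand 1 pays for rounding
    the number of points up. *)
Theorem discretization_of_entropy {R : realType} (p q : R) :
  1 <= q -> q <= p ->
  exists2 C : R, 0 <= C & forall d (T : measurableType d) (mu : probability T R)
    (N : nat) (X : set (T -> R)) (B : R),
  (forall f, X f -> measurable_fun setT f) ->
  (forall (c : R) f, X f -> X (fun x => c * f x)) ->
  (forall f, X f -> (\int[mu]_x (`|f x| `^ p)%:E < +oo)%E) ->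
  (0 < N)%N -> 1 <= B ->
  (forall k, (0 < k)%N -> (entropy_number uniform_norm (Lnorm_ball mu q X) k
      <= (B * (N%:R / k%:R) `^ (1 / q))%:E)%E) ->
  exists (m : nat) (z : 'I_m -> T), [/\ (0 < m)%N,
    m%:R <= C * (B `^ p * N%:R `^ (p / q) * log2 (2 * B * N%:R) ^+ 2)
  & forall f, X f ->
    ((1 / 2)%:E * \int[mu]_x (`|f x| `^ p)%:E
       <= (m%:R^-1 * \sum_(k < m) `|f (z k)| `^ p)%:E)%E /\
    ((m%:R^-1 * \sum_(k < m) `|f (z k)| `^ p)%:E
       <= (3 / 2)%:E * \int[mu]_x (`|f x| `^ p)%:E)%E].
Proof.
move=> q1 qp; have p1 : 1 <= p := le_trans q1 qp.
have p0 : 0 < p := lt_le_trans ltr01 p1.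
have q0 : 0 < q := lt_le_trans ltr01 q1.
pose K : R := 21 / 20.
have K1 : 1 < K by rewrite /K; lra.
have lnK0 : 0 < ln K by exact: ln_gt0.
pose a : R := 1 - (K `^ p^-1)^-1.
pose c : R := (ln 20 + p * ln 2) / ln K + 4.
pose D : R := (2 * 40^-1 ^+ 2)^-1.
have D0 : 0 < D by rewrite invr_gt0 mulr_gt0// exprn_gt0// invr_gt0.
have ln2 : 0 < ln 2 :> R by rewrite ln_gt0// ltr1n.
have ln20 : 0 < ln 20 :> R by rewrite ln_gt0// ltr1n.
have c0 : 0 < c by rewrite addr_gt0// divr_gt0// addr_gt0// mulr_gt0.
exists (1 + D * c ^+ 2 * (2 / a) `^ p).
  by rewrite addr_ge0// mulr_ge0 ?powR_ge0// mulr_ge0 ?sqr_ge0// ltW.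
move=> d T mu N X B XM XZ Xfin N0 B1 ent.
pose V := B * N%:R `^ q^-1.
have B0 : 0 < B := lt_le_trans ltr01 B1.
have V1 : 1 <= V := scale_ge1 q1 N0 B1.
have V0 : 0 < V := lt_le_trans ltr01 V1.
have N1 : 1 <= N%:R :> R by rewrite ler1n.
pose L := log2 (2 * B * N%:R).
have BN : 2 <= 2 * B * N%:R by rewrite -mulrA ler_peMr// mulr_ege1.
have L1 : 1 <= L.
  by rewrite /L /log2 ler_pdivlMr// mul1r ler_ln// posrE// (lt_le_trans _ BN).
have VL : ln (2 * V) <= ln 2 * L.
  rewrite /L /log2 [ln 2 * _]mulrC divfK ?gt_eqF// ler_ln ?posrE ?mulr_gt0//.
  - rewrite -mulrA ler_pM2l// /V ler_pM2l//.
    by rewrite -[leRHS](powRr1 (ler0n _ N)) ler_powR// invf_le1.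
  - by rewrite powR_gt0// ltr0n.
  - by rewrite ltr0n.
have Y1 : 1 <= (2 * V) `^ p.
  rewrite -[leLHS](powRr0 (2 * V)) ler_powR//; last exact: ltW.
  by lra.
have [n [n0 top lev nle]] := exists_level_count K1 Y1.
have nL : n%:R + 3 <= c * L.
  have : ln (20 * (2 * V) `^ p) <= (ln 20 + p * ln 2) * L.
    rewrite lnM ?posrE ?(lt_le_trans ltr01 Y1)// ln_powR [leRHS]mulrDl lerD//.
      by rewrite ler_peMr// (ltW ln20).
    by rewrite -mulrA ler_pM2l.
  rewrite -(ler_pM2r (_ : 0 < (ln K)^-1)) ?invr_gt0// => h.
  apply: le_trans (_ : (1 + ln (20 * (2 * V) `^ p) / ln K) + 3 <= _).
    by rewrite lerD2r.
  have -> : c * L = (ln 20 + p * ln 2) * L / ln K + 4 * L.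
    by rewrite /c [LHS]mulrDl [X in X + _]mulrAC.
  by lra.
pose W := (2 * V / a) `^ p.
pose m := (Num.trunc (D * (n%:R * ((n%:R + 3) * W)))).+1.
have m_large : n%:R * ((n%:R + 3) * W) <= 2 * 40^-1 ^+ 2 * m%:R.
  have : D * (n%:R * ((n%:R + 3) * W)) <= m%:R by exact/ltW/truncnS_gt.
  by rewrite /D ler_pdivrMl// mulr_gt0// exprn_gt0// invr_gt0.
pose A : set (T -> R) := [set f | X f /\ (\int[mu]_x (`|f x| `^ q)%:E <= 1)%E].
have pA f : X f -> (\int[mu]_x (`|f x| `^ p)%:E <= 1)%E -> A f.
  move=> Xf fp; split; first exact: Xf.
  have mXf := XM f Xf.
  have qp1 : 0 <= 1 - q / p by rewrite subr_ge0 ler_pdivrMr// mul1r.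
  have qp0 : 0 <= q / p by rewrite divr_ge0 ?(ltW p0) ?(ltW q0).
  have mfp r : measurable_fun setT (fun x => `|f x| `^ r).
    exact: measurable_norm_powR.
  apply: le_trans (_ : \int[mu]_x ((1 - q / p) + q / p * `|f x| `^ p)%:E <= _)%E.
    apply: ge0_le_integral_EFin => //.
    - by apply: measurable_funD => //; exact: measurable_funM.
    - by move=> x; exact: powR_le_affine.
  under eq_integral do rewrite EFinD.
  rewrite ge0_integralD//=; last 2 first.
  - by move=> x _; rewrite lee_fin mulr_ge0 ?powR_ge0.
  - by apply/measurable_EFinP/measurable_funM.
  rewrite ge0_integral_EFinZl//.
  rewrite integral_probability_cst.
  apply: le_trans (_ : (1 - q / p)%:E + (q / p)%:E * 1 <= _)%E.
    by rewrite leeD2l// lee_wpmul2l// lee_fin.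
  by rewrite mule1 -EFinD lee_fin subrK.
have Abd f : A f -> forall x, `|f x| <= 2 * V.
  by move=> Af x; apply: (ball_bounded q1 N0 B1 XM XZ ent Af).
have [z zP] := @normalized_discretization R d T mu p V X A n m p1 V1 XM
  (fun f => @proj1 _ _)
  Abd (fun r => net_of_radius q1 N0 B1 ent qp) n0 top lev m_large.
exists m, (fun k : 'I_m => z k); split=> //.
- have : m%:R <= D * (n%:R * ((n%:R + 3) * W)) + 1.
    rewrite /m -addn1 natrD lerD2r truncn_le mulr_ge0 ?(ltW D0)// mulr_ge0//.
    by rewrite mulr_ge0 ?powR_ge0// addr_ge0.
  have a0 : 0 <= a.
    rewrite /a subr_ge0 invf_le1 ?powR_gt0 ?(lt_trans ltr01 K1)//.
    by rewrite -[leLHS](powRr0 K) ler_powR ?(ltW K1)// invr_ge0 ltW.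
  have WE : W = (2 / a) `^ p * V `^ p.
    by rewrite -powRM ?(ltW V0) ?divr_ge0// mulrAC.
  have VE : V `^ p = B `^ p * N%:R `^ (p / q).
    by rewrite powRM ?powR_ge0 ?(ltW B0)// -powRrM [q^-1 * p]mulrC.
  rewrite -/L -VE => /le_trans; apply.
  rewrite [leRHS]mulrDl mul1r addrC lerD//.
    rewrite mulr_ege1//; last exact: exprn_ege1.
    by rewrite -[leLHS](powRr0 V) ler_powR// ltW.
  have -> : D * c ^+ 2 * (2 / a) `^ p * (V `^ p * L ^+ 2) =
      D * (c * L * (c * L * W)) by rewrite WE; ring.
  rewrite ler_pM2l// ler_pM//.
  - by rewrite mulr_ge0 ?powR_ge0// addr_ge0.
  - by apply: le_trans nL; rewrite lerDl.
  - by rewrite ler_wpM2r// powR_ge0.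
- move=> f Xf; apply: (homogeneous_extension p0 XM XZ) => //; last exact: Xfin.
    (* all multiples of a function of zero norm lie in the ball, which is
       bounded uniformly *)
    move=> g Xg g0 x; apply/eqP; rewrite -normr_le0; apply/ler_addgt0Pr => e e0.
    pose t := 2 * V / e.
    have t0 : 0 < t by rewrite divr_gt0// mulr_gt0.
    have At : A (fun x => t * g x).
      apply: pA; first exact: XZ.
      under eq_integral do rewrite normrM powRM//.
      rewrite ge0_integral_EFinZl ?powR_ge0//; last first.
        by apply: measurable_norm_powR; exact: XM.
      by rewrite g0 mule0.
    have := Abd _ At x; rewrite normrM (gtr0_norm t0) /t.
    rewrite add0r [_ / e * _]mulrAC ler_pdivrMr// ler_pM2l//.
    by rewrite mulr_gt0.
  by move=> g Xg g1; apply: zP => //; apply: pA => //; rewrite g1.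
Qed.
(** * Iterated integrals and iterated averages *)

Section dependent_update.
Context {I : eqType} {T : I -> Type}.
Implicit Types x : forall i, T i.

Lemma dfwith_id x i (y y' : T i) : dfwith (dfwith x i y) i y' = dfwith x i y'.
Proof.
apply: functional_extensionality_dep => j; have [<-|ij] := eqVneq i j.
  by rewrite !dfwithin.
by rewrite !dfwithout.
Qed.

Lemma dfwithC x i j (y : T i) (y' : T j) : i != j ->
  dfwith (dfwith x i y) j y' = dfwith (dfwith x j y') i y.
Proof.
move=> ij; have ji : j != i by rewrite eq_sym.
apply: functional_extensionality_dep => k.
have [<-|ik] := eqVneq i k; first by rewrite dfwithout// !dfwithin.
have [<-|jk] := eqVneq j k; first by rewrite dfwithin dfwithout// dfwithin.
by rewrite !dfwithout.
Qed.

End dependent_update.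

Section iterated_integral.
Context {R : realType} {s : nat} {d : 'I_s -> measure_display}.
Context {T : forall i, measurableType (d i)}.
Variable mu : forall i, probability (T i) R.
Local Open Scope ereal_scope.

Lemma le_iter_integral r (g h : pi_space T -> \bar R) :
  measurable_fun setT g -> measurable_fun setT h -> (forall x, 0 <= g x) ->
  (forall x, g x <= h x) ->
  forall x, iter_integral mu r g x <= iter_integral mu r h x.
Proof.
move=> mg mh g0 gh; have h0 x : 0 <= h x := le_trans (g0 x) (gh x).
elim: r => //= i r IH x; apply: ge0_le_integral => //.
- by move=> y _; exact: iter_integral_ge0.
- apply: (measurableT_comp (measurable_iter_integral _ _ mg g0)).
  exact: measurable_dfwith1.
- apply: (measurableT_comp (measurable_iter_integral _ _ mh h0)).
  exact: measurable_dfwith1.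
Qed.

Lemma iter_integralZl r (c : R) (g : pi_space T -> \bar R) : (0 <= c)%R ->
  measurable_fun setT g -> (forall x, 0 <= g x) ->
  forall x, iter_integral mu r (fun x => c%:E * g x) x =
    c%:E * iter_integral mu r g x.
Proof.
move=> c0 mg g0; elim: r => //= i r IH x; rewrite /integral_coord.
under eq_integral do rewrite IH.
apply: ge0_integralZl => //.
- apply: (measurableT_comp (measurable_iter_integral _ _ mg g0)).
  exact: measurable_dfwith1.
- by move=> y _; exact: iter_integral_ge0.
Qed.

End iterated_integral.

Section sampling.
Context {R : realType} {s : nat} {d : 'I_s -> measure_display}.
Context {T : forall i, measurableType (d i)}.
Variable mu : forall i, probability (T i) R.
Variables (mm : 'I_s -> nat) (z : forall i, 'I_(mm i) -> T i).
Hypothesis mm_gt0 : forall i, (0 < mm i)%N.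

Definition sample_coord (i : 'I_s) (g : pi_space T -> R) : pi_space T -> R :=
  fun x => (mm i)%:R^-1 * \sum_(k < mm i) g (dfwith x i (z k)).

Definition iter_sample (r : seq 'I_s) (g : pi_space T -> R) : pi_space T -> R :=
  foldr sample_coord g r.

Let mmV i : (mm i)%:R^-1 * (mm i)%:R = 1 :> R.
Proof. by rewrite mulVf// pnatr_eq0 -lt0n. Qed.

(** The sum ranges over all multi-indices, not only over the coordinates in [r];
    the remaining coordinates of [phi] are averaged out.  This keeps the index
    type fixed during the induction. *)
Lemma iter_sampleE r g x : uniq r ->
  iter_sample r g x = (\prod_i (mm i)%:R)^-1 *
    \sum_(phi : {dffun forall i, 'I_(mm i)})
      g (fun i => if i \in r then z (phi i) else x i).
Proof.
elim: r x => [x _|i r IH x /= /andP[ir ur]].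
  rewrite /= sumr_const -[_ *+ _]mulr_natl mulrA.
  have -> : #|{: {dffun forall i, 'I_(mm i)}}|%:R = \prod_i (mm i)%:R :> R.
    rewrite card_dep_ffun foldrE big_map big_enum/= natr_prod.
    by apply: eq_bigr => i _; rewrite card_ord.
  rewrite mulVf ?mul1r//; apply/prodf_neq0 => i _.
  by rewrite pnatr_eq0 -lt0n.
pose D := {dffun forall i, 'I_(mm i)}.
pose upd (phi : D) (k : 'I_(mm i)) : D := [ffun j => dfwith phi i k j].
pose F (phi : D) := g (fun j => if j \in i :: r then z (phi j) else x j).
change (sample_coord i (iter_sample r g) x =
  (\prod_i (mm i)%:R)^-1 * \sum_phi F phi).
transitivity ((mm i)%:R^-1 * \sum_(k < mm i)
    (\prod_i (mm i)%:R)^-1 * \sum_(phi : D) F (upd phi k)).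
  congr (_ * _); apply: eq_bigr => k _; rewrite IH//; congr (_ * _).
  apply: eq_bigr => phi _; congr g; apply: functional_extensionality_dep => j.
  rewrite /upd ffunE in_cons; have [->|ji] := eqVneq j i.
    by rewrite (negbTE ir)/= !dfwithin.
  by rewrite /= !dfwithout// eq_sym.
rewrite -mulr_sumr mulrCA; congr (_ * _).
rewrite pair_bigA/=.
(* exchanging k with the i-th entry of phi is an involution that turns a
   function of the updated multi-index into one constant in k *)
pose swap (kp : 'I_(mm i) * D) := (kp.2 i, upd kp.2 kp.1).
have swapK : involutive swap.
  move=> [k phi]; rewrite /swap/= /upd; congr (_, _).
    by rewrite ffunE dfwithin.
  apply/ffunP => j; rewrite !ffunE; have [<-|ij] := eqVneq i j.
    by rewrite dfwithin.
  by rewrite dfwithout// ffunE dfwithout.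
rewrite (reindex_inj (inv_inj swapK))/=.
have -> : \sum_(kp : 'I_(mm i) * D) F (upd (swap kp).2 (swap kp).1) =
    \sum_(kp : 'I_(mm i) * D) F kp.2.
  apply: eq_bigr => kp _; congr F.
  by have := swapK kp; rewrite {1}/swap => /(congr1 snd).
rewrite -(pair_bigA _ (fun _ phi => F phi))/= sumr_const card_ord.
by rewrite -[X in _ * X]mulr_natl mulrA mmV mul1r.
Qed.

Section two_sided.
Variables a b : R.
Hypotheses (a0 : 0 <= a) (a1 : a <= 1) (b1 : 1 <= b).

Definition coord_discretized (g : pi_space T -> R) : Prop :=
  [/\ measurable_fun setT g, forall x, 0 <= g x
    & forall i x,
      (a%:E * integral_coord mu i (EFin \o g) x <= (sample_coord i g x)%:E)%E /\
      ((sample_coord i g x)%:E <= b%:E * integral_coord mu i (EFin \o g) x)%E].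

Let b0 : 0 <= b. Proof. exact: le_trans ler01 b1. Qed.

Lemma sample_coord_ge0 i g :
  (forall x, 0 <= g x) -> forall x, 0 <= sample_coord i g x.
Proof. by move=> g0 x; rewrite mulr_ge0 ?invr_ge0// sumr_ge0. Qed.

Lemma measurable_sample_coord i g :
  measurable_fun setT g -> measurable_fun setT (sample_coord i g).
Proof.
move=> mg; apply: measurable_funM => //; apply: measurable_sum => k.
apply: (measurableT_comp mg); apply: measurable_to_pi_space => j.
have [<-|ij] := eqVneq i j.
  rewrite (_ : (fun x : pi_space T => _) = cst (z k)).
    exact: measurable_cst.
  by apply/funext => x; rewrite dfwithin.
rewrite (_ : (fun x : pi_space T => _) = (fun x : pi_space T => x j)).
  exact: measurable_coord.
by apply/funext => x; rewrite dfwithout.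
Qed.

Lemma sample_coordC i j g x : i != j ->
  sample_coord i (sample_coord j g) x = sample_coord j (sample_coord i g) x.
Proof.
move=> ij; rewrite /sample_coord.
under eq_bigr do rewrite mulr_sumr. under [in RHS]eq_bigr do rewrite mulr_sumr.
rewrite exchange_big/= !mulr_sumr; apply: eq_bigr => l _.
rewrite !mulr_sumr; apply: eq_bigr => k _.
by rewrite mulrCA dfwithC.
Qed.

(** Sampling in the coordinate [j] commutes with sampling and integrating in any
    other coordinate, and it is monotone.  In the coordinate [j] itself the
    sampled function is constant, so that its mean and its integral coincide;
    here a <= 1 <= b is used. *)
Lemma coord_discretized_sample j g :
  coord_discretized g -> coord_discretized (sample_coord j g).
Proof.
move=> [mg g0 gP]; split; [exact: measurable_sample_coord|exact: sample_coord_ge0|].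
move=> i x; have [<-{j}|ij] := eqVneq i j.
  have SE y : sample_coord i g (dfwith x i y) = sample_coord i g x.
    rewrite /sample_coord; congr (_ * _).
    by apply: eq_bigr => k _; rewrite dfwith_id.
  have -> : integral_coord mu i (EFin \o sample_coord i g) x =
      (sample_coord i g x)%:E.
    rewrite /integral_coord; under eq_integral do rewrite /= SE.
    exact: integral_probability_cst.
  have -> : sample_coord i (sample_coord i g) x = sample_coord i g x.
    rewrite {1}/sample_coord; under eq_bigr do rewrite SE.
    by rewrite sumr_const card_ord -[X in _ * X]mulr_natl mulrA mmV mul1r.
  have S0 : 0 <= sample_coord i g x by exact: sample_coord_ge0.
  by rewrite -!EFinM !lee_fin; split; [rewrite ler_piMl|rewrite ler_peMl].
have mgx (x' : pi_space T) :
    measurable_fun setT (fun y : T i => g (dfwith x' i y : pi_space T)).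
  by apply: (measurableT_comp mg); exact: measurable_dfwith1.
have -> : integral_coord mu i (EFin \o sample_coord j g) x =
   (((mm j)%:R^-1)%:E *
     \sum_(k < mm j) integral_coord mu i (EFin \o g) (dfwith x j (z k)))%E.
  rewrite /integral_coord /= /sample_coord.
  rewrite (ge0_integral_EFinZl (mu i) (f := fun y =>
    \sum_(k < mm j) g (dfwith (dfwith x i y) j (z k)))).
  - congr (_ * _)%E; under eq_integral do rewrite -sumEFin.
    rewrite ge0_integral_sum//.
    + apply: eq_bigr => k _; apply: eq_integral => y _.
      by rewrite dfwithC.
    + move=> k; apply/measurable_EFinP.
      by under eq_fun do rewrite dfwithC//; exact: mgx.
    + by move=> k y _; rewrite lee_fin.
  - apply: measurable_sum => k.
    by under eq_fun do rewrite dfwithC//; exact: mgx.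
  - by rewrite invr_ge0.
  - by move=> y; rewrite sumr_ge0.
rewrite sample_coordC// {2 3}/sample_coord EFinM -sumEFin.
have I0 k : (0 <= integral_coord mu i (EFin \o g) (dfwith x j (z k)))%E.
  by apply: integral_ge0 => y _; rewrite lee_fin.
have V0 : (0 <= ((mm j)%:R^-1 : R)%:E)%E by rewrite lee_fin invr_ge0.
rewrite !(muleCA _ ((mm j)%:R^-1)%:E).
split; apply: lee_wpmul2l => //; rewrite ge0_sume_distrr//; apply: lee_sum => k _.
- exact: (gP i _).1.
- exact: (gP i _).2.
Qed.

(** The induction removes the last, that is innermost, coordinate: its integral
    is compared with the average, which is again a function to which the
    induction hypothesis applies, and the comparison survives the outer
    integrals by monotonicity. *)
Lemma iter_discretized r g : coord_discretized g -> forall x,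
  ((a ^+ size r)%:E * iter_integral mu r (EFin \o g) x
     <= (iter_sample r g x)%:E)%E /\
  ((iter_sample r g x)%:E
     <= (b ^+ size r)%:E * iter_integral mu r (EFin \o g) x)%E.
Proof.
elim/last_ind: r g => [g _ x|r i IH g gP x]; first by rewrite !expr0 !mul1e.
have [mg g0 gi] := gP.
have [mS S0 _] := coord_discretized_sample i gP.
have [lo hi] := IH _ (coord_discretized_sample i gP) x.
rewrite /iter_integral /iter_sample !foldr_rcons size_rcons.
rewrite -/(iter_integral mu r _) -/(iter_sample r _).
have mE : measurable_fun setT (EFin \o g) by exact/measurable_EFinP.
have E0 y : (0 <= (EFin \o g) y)%E by rewrite lee_fin.
have mI : measurable_fun setT (integral_coord mu i (EFin \o g)).
  exact: (measurable_iter_integral mu [:: i] mE E0).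
have I0 y : (0 <= integral_coord mu i (EFin \o g) y)%E.
  exact: (iter_integral_ge0 mu [:: i] E0).
have mSE : measurable_fun setT (EFin \o sample_coord i g) by exact/measurable_EFinP.
split.
- apply: le_trans lo; rewrite exprSr EFinM -muleA lee_wpmul2l//.
    by rewrite lee_fin exprn_ge0.
  rewrite -iter_integralZl//; apply: le_iter_integral => //.
  + exact: emeasurable_funM.
  + by move=> y; rewrite mule_ge0// lee_fin.
  + by move=> y; exact: (gi i y).1.
- apply: (le_trans hi); rewrite exprSr EFinM -muleA lee_wpmul2l//.
    by rewrite lee_fin exprn_ge0.
  rewrite -iter_integralZl//; apply: le_iter_integral => //.
  + exact: emeasurable_funM.
  + by move=> y; exact: (gi i y).2.
Qed.

End two_sided.
End sampling.
(** * The product integral as an iterated integral *)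

Section iterated_integral_limits.
Context {R : realType} {s : nat} {d : 'I_s -> measure_display}.
Context {T : forall i, measurableType (d i)}.
Variable mu : forall i, probability (T i) R.
Local Open Scope ereal_scope.
Import HBNNSimple.

Lemma iter_integral_sum r (I : Type) (l : seq I) (g : I -> pi_space T -> \bar R) :
  (forall i, measurable_fun setT (g i)) -> (forall i x, 0 <= g i x) ->
  forall x, iter_integral mu r (fun x => \sum_(i <- l) g i x) x =
    \sum_(i <- l) iter_integral mu r (g i) x.
Proof.
move=> mg g0; elim: r => //= i r IH x; rewrite /integral_coord.
under eq_integral do rewrite IH.
apply: ge0_integral_sum => //.
- move=> k; apply: (measurableT_comp (measurable_iter_integral _ _ (mg k) (g0 k))).
  exact: measurable_dfwith1.
- by move=> k y _; exact: iter_integral_ge0.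
Qed.

Lemma iter_integral_lim r (g : (pi_space T -> \bar R)^nat) :
  (forall n, measurable_fun setT (g n)) -> (forall n x, 0 <= g n x) ->
  (forall x, {homo g^~ x : n m / (n <= m)%N >-> n <= m}) ->
  forall x, iter_integral mu r (fun x => limn (g^~ x)) x =
    limn (fun n => iter_integral mu r (g n) x).
Proof.
move=> mg g0 nd; elim: r => //= i r IH x; rewrite /integral_coord.
under eq_integral do rewrite IH.
apply: monotone_convergence => //.
- move=> n; apply: (measurableT_comp (measurable_iter_integral _ _ (mg n) (g0 n))).
  exact: measurable_dfwith1.
- by move=> n y _; exact: iter_integral_ge0.
- move=> y _ n m nm; apply: le_iter_integral => // x'; exact: nd.
Qed.

Let integral_simple (a : {nnsfun (pi_space T) >-> R}) :
  \int[product_measure mu]_x (a x)%:E =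
  iter_integral mu (enum 'I_s) (fun x => (a x)%:E) point.
Proof.
pose l := finmap.enum_fset (fset_set (range a)).
(* the maximum with 0 makes the summand nonnegative for every y; the values of a
   are nonnegative, so it changes nothing on the range *)
pose F (y : R) (x : pi_space T) : \bar R :=
  (Num.max y 0)%:E * (\1_(a @^-1` [set y]) x)%:E.
have aE : (fun x => (a x)%:E) = fun x => \sum_(y <- l) F y x.
  apply/funext => x; rewrite fimfunE fsbig_finite//= -sumEFin.
  rewrite big_seq [RHS]big_seq; apply: eq_bigr => y.
  rewrite in_fset_set// inE => -[x' _ <-].
  have ax0 : (0 <= a x')%R by exact: fun_ge0.
  by rewrite EFinM /F (max_idPl ax0).
have mI y : measurable_fun setT
    (fun x : pi_space T => (\1_(a @^-1` [set y]) x : R)%:E).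
  by apply/measurable_EFinP/measurable_indic.
have max0 (y : R) : (0 <= Num.max y 0)%R by rewrite le_max lexx orbT.
have mF y : measurable_fun setT (F y) by exact: emeasurable_funM.
have F0 y x : 0 <= F y x by rewrite mule_ge0// lee_fin.
rewrite aE iter_integral_sum// ge0_integral_sum//.
apply: eq_bigr => y _; rewrite /F ge0_integralZl//; last by rewrite lee_fin.
rewrite iter_integralZl//; congr (_ * _).
  by rewrite integral_indic// setIT.
Qed.

(** On indicators this is the definition of the product measure; simple functions
    and increasing limits give the general case. *)
Lemma integral_product_measure (g : pi_space T -> \bar R) :
  measurable_fun setT g -> (forall x, 0 <= g x) ->
  \int[product_measure mu]_x g x = iter_integral mu (enum 'I_s) g point.
Proof.
move=> mg g0; pose a := nnsfun_approx measurableT mg.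
have acvg x : (fun n => (a n x)%:E) @ \oo --> g x by exact: cvg_nnsfun_approx.
have -> : g = fun x => limn (fun n => (a n x)%:E).
  by apply/funext => x; apply/esym/cvg_lim => //; exact: acvg.
have nd x : {homo (fun n => (a n x)%:E) : n m / (n <= m)%N >-> n <= m}.
  by move=> n m nm; rewrite lee_fin; exact/lefP/nd_nnsfun_approx.
have ma n : measurable_fun setT (fun x => (a n x)%:E).
  exact/measurable_EFinP.
have a0 n x : 0 <= (a n x)%:E by rewrite lee_fin.
rewrite monotone_convergence//.
rewrite (iter_integral_lim _ ma a0 nd).
by congr (limn _); apply/funext => n; exact: integral_simple.
Qed.

End iterated_integral_limits.
(** * Spans, sections and continuity *)

Section linear_span.
Context {R : realType} {T : Type} (G : set (T -> R)).

Lemma lin_span0 : lin_span G (fun=> 0).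
Proof.
exists 0%N, (fun=> 0), (fun _ _ => 0); split; first by case.
by apply/funext => x; rewrite big_ord0.
Qed.

Lemma lin_spanZ (c : R) f : lin_span G f -> lin_span G (fun x => c * f x).
Proof.
move=> [n [a [g [Gg ->]]]]; exists n, (fun k => c * a k), g; split=> //.
by apply/funext => x; rewrite mulr_sumr; apply: eq_bigr => k _; rewrite mulrA.
Qed.

Lemma lin_spanD f1 f2 : lin_span G f1 -> lin_span G f2 ->
  lin_span G (fun x => f1 x + f2 x).
Proof.
move=> [n1 [a1 [g1 [Gg1 ->]]]] [n2 [a2 [g2 [Gg2 ->]]]].
exists (n1 + n2)%N,
  (fun k => match fintype.split k with inl i => a1 i | inr j => a2 j end),
  (fun k => match fintype.split k with inl i => g1 i | inr j => g2 j end).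
split; first by move=> k; case: fintype.split.
apply/funext => x; rewrite big_split_ord/=.
by congr (_ + _); apply: eq_bigr => k _;
  rewrite (unsplitK (inl k), unsplitK (inr k)).
Qed.

Lemma lin_span_sum n (c : 'I_n -> R) (g : 'I_n -> T -> R) :
  (forall k, lin_span G (g k)) -> lin_span G (fun x => \sum_k c k * g k x).
Proof.
elim: n c g => [|n IH] c g Gg.
  rewrite (_ : (fun x => _) = fun=> 0); first exact: lin_span0.
  by apply/funext => x; rewrite big_ord0.
rewrite (_ : (fun x => _) = fun x => c ord0 * g ord0 x
    + \sum_(k < n) c (lift ord0 k) * g (lift ord0 k) x); last first.
  by apply/funext => x; rewrite big_ord_recl.
by apply: lin_spanD; [exact: lin_spanZ | exact: IH].
Qed.

End linear_span.

Section borel_subspace.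
Context {R : realType} {T : topologicalType} {A : set T} (x0 : A).
Variable f : borel_sub x0 -> R.
Hypothesis cf : continuous f.

Lemma continuous_borel_sub_measurable : measurable_fun setT f.
Proof.
apply: (measurability _ (RGenOpens.measurableE R)) => _ [_ [a [b ->] <-]].
rewrite setTI; apply: sub_sigma_algebra.
by move/continuousP: cf; apply; exact: interval_open.
Qed.

(** A function on the subspace [A] is extended by 0 to the ambient space, where
    it is continuous within the compact set [A]. *)
Lemma continuous_borel_sub_bounded : compact A ->
  exists M, forall x, `|f x| <= M.
Proof.
move=> cA.
pose g (y : T) : R := if insub y is Some x then f (x : A) else 0.
have gE (x : A) : g (val x) = f x by rewrite /g valK.
have cg : {within A, continuous g}.
  apply/subspace_sigL_continuousP.
  rewrite (_ : sigL A g = f) //.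
  by apply/funext => x; rewrite /sigL/= -gE.
have /compact_bounded[M [_ MP]] := continuous_compact cg cA.
exists (M + 1) => x; apply: (MP (M + 1)); first by rewrite ltrDl.
by exists (val x); [exact: set_mem (valP x)|exact: gE].
Qed.

End borel_subspace.

Lemma integral_bounded_powR_fin {R : realType} d (T : measurableType d)
    (mu : probability T R) (p M : R) (f : T -> R) : 0 <= p ->
  measurable_fun setT f -> (forall x, `|f x| <= M) ->
  (\int[mu]_x (`|f x| `^ p)%:E < +oo)%E.
Proof.
move=> p0 mf fM; have M0 : 0 <= M := le_trans (normr_ge0 _) (fM point).
apply: (@le_lt_trans _ _ (M `^ p)%:E); last exact: ltry.
rewrite -[leRHS](integral_probability_cst mu).
apply: ge0_le_integral_EFin => //; first exact: measurable_norm_powR.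
by move=> x; apply: ge0_ler_powR; rewrite ?nnegrE.
Qed.

Section tensor_sections.
Context {R : realType} {s : nat} {d : 'I_s -> measure_display}.
Context {T : forall i, measurableType (d i)}.
Variable X : forall i, set (T i -> R).
Arguments X : clear implicits.
Hypothesis XM : forall i f, X i f -> measurable_fun setT f.

Lemma measurable_tensor_space (f : pi_space T -> R) :
  tensor_space X f -> measurable_fun setT f.
Proof.
move=> [n [c [F [FX ->]]]]; apply: measurable_sum => k.
apply: measurable_funM => //; have [g [Xg ->]] := FX k.
apply: measurable_prod => i _.
by apply: (measurableT_comp (XM (Xg i))); exact: measurable_coord.
Qed.

Lemma tensor_space_section (f : pi_space T -> R) (x : pi_space T) i
    (G : set (T i -> R)) : X i = lin_span G -> tensor_space X f ->
  X i (fun y => f (dfwith x i y)).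
Proof.
move=> XG [n [c [F [FX ->]]]].
have /all_sig[g gP] : forall k, {g : forall i, T i -> R |
    (forall i, X i (g i)) /\ F k = fun x => \prod_(i < s) g i (x i)}.
  by move=> k; exact/cid/FX.
rewrite XG (_ : (fun y => _) = fun y =>
    \sum_(k < n) (c k * \prod_(j < s | j != i) g k j (x j)) * g k i y).
  by apply: lin_span_sum => k; rewrite -XG; case: (gP k).
apply/funext => y; apply: eq_bigr => k _.
rewrite (gP k).2 (bigD1 i)//= dfwithin [g k i y * _]mulrC mulrA.
congr (_ * _ * _).
by apply: eq_bigr => j ji; rewrite dfwithout// eq_sym.
Qed.

End tensor_sections.

(** * Tensor product discretization *)

Theorem proposition3p1 (R : realType) (p q : R) (s : nat)
    (q_ge1 : 1 <= q) (q_le_p : q <= p) (s_gt0 : (0 < s)%N) :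
  exists C : R,
  forall (dim : 'I_s -> nat) (Omega : forall i, set 'rV[R]_(dim i))
    (x0 : forall i, Omega i)
    (mu : forall i, probability (borel_sub (x0 i)) R)
    (N : 'I_s -> nat) (X : forall i, set (borel_sub (x0 i) -> R))
    (B : 'I_s -> R),
  (forall i, compact (Omega i)) ->
  (forall i, (0 < N i)%N) ->
  (forall i, X i `<=` [set f | continuous f]) ->
  (forall i, subspace_of_dim (X i) (N i)) ->
  (forall i, 1 <= B i) ->
  (forall i k, (0 < k)%N ->
     (entropy_number uniform_norm (Lnorm_ball (mu i) q (X i)) k
      <= (B i * ((N i)%:R / k%:R) `^ (1 / q))%:E)%E) ->
  exists (m : nat) (xi : 'I_m -> forall i, borel_sub (x0 i)),
    [/\ (0 < m)%N,
        tensor_product_structure xi,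
        m%:R <= C * \prod_(i < s) (B i `^ p * (N i)%:R `^ (p / q)
                                   * log2 (2 * B i * (N i)%:R) ^+ 2)
      & forall f, tensor_space X f ->
          (((1 / 2) ^+ s)%:E * 'N[product_measure mu]_p%:E[EFin \o f] `^ p
             <= (m%:R^-1 * \sum_(j < m) `|f (xi j)| `^ p)%:E)%E /\
          ((m%:R^-1 * \sum_(j < m) `|f (xi j)| `^ p)%:E
             <= ((3 / 2) ^+ s)%:E
                * 'N[product_measure mu]_p%:E[EFin \o f] `^ p)%E].
Proof.
have p0 : 0 < p by rewrite (lt_le_trans _ q_le_p)// (lt_le_trans _ q_ge1).
have [C C0 CP] := @discretization_of_entropy R p q q_ge1 q_le_p.
exists (C ^+ s) => dim Omega x0 mu N X B cO N0 Xc Xdim B1 ent.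
have XM i f : X i f -> measurable_fun setT f.
  by move=> Xf; apply: continuous_borel_sub_measurable; exact: Xc.
have XG i : exists G, X i = lin_span G by have [b _ ->] := Xdim i; exists (range b).
have XZ i (c : R) f : X i f -> X i (fun x => c * f x).
  by have [G ->] := XG i; exact: lin_spanZ.
have Xfin i f : X i f -> (\int[mu i]_x (`|f x| `^ p)%:E < +oo)%E.
  move=> Xf; have [M fM] := continuous_borel_sub_bounded (Xc i f Xf) (cO i).
  by apply: (integral_bounded_powR_fin _ (ltW p0)) fM; exact: XM.
have /all_sig [mm /(_ _)/cid mmP] i := cid (CP _ _ (mu i) (N i) (X i) (B i)
  (XM i) (XZ i) (Xfin i) (N0 i) (B1 i) (ent i)).
pose z i := sval (mmP i).
have zP i := svalP (mmP i).
have mm0 i : (0 < mm i)%N by case: (zP i).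
pose m := (\prod_(i < s) mm i)%N.
have cardm : m = #|{: {dffun forall i : 'I_s, 'I_(mm i)}}|.
  rewrite card_dep_ffun foldrE big_map big_enum/=.
  by apply: eq_bigr => i _; rewrite card_ord.
pose h (j : 'I_m) : {dffun forall i : 'I_s, 'I_(mm i)} :=
  enum_val (cast_ord cardm j).
have bh : bijective h.
  exists (fun phi => cast_ord (esym cardm) (enum_rank phi)) => [j|phi].
    by rewrite /h enum_valK cast_ordK.
  by rewrite /h cast_ordKV enum_rankK.
exists m, (fun j i => z i (h j i)); split.
- by rewrite /m; apply: prodn_gt0.
- by exists mm, z, h.
- rewrite /m natr_prod -[X in C ^+ X]card_ord -prodr_const -big_split/=.
  by apply: ler_prod => i _; rewrite ler0n/=; case: (zP i).
move=> f tf; pose g (x : pi_space _) : R := `|f x| `^ p.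
have mf : measurable_fun setT (f : pi_space _ -> R).
  exact: (measurable_tensor_space XM tf).
have gd : coord_discretized mu z (1 / 2) (3 / 2) g.
  split.
  - exact: measurable_norm_powR.
  - by move=> x; exact: powR_ge0.
  move=> i x; have [G XGi] := XG i.
  by have [_ _ /(_ _ (tensor_space_section x XGi tf))] := zP i.
have sampleE x : iter_sample z (enum 'I_s) g x =
    m%:R^-1 * \sum_(j < m) `|f (fun i => z i (h j i))| `^ p.
  rewrite (iter_sampleE z mm0) ?enum_uniq// /m natr_prod; congr (_ * _).
  rewrite (reindex h (onW_bij _ bh)); apply: eq_bigr => j _.
  congr (`|f _| `^ _); apply: functional_extensionality_dep => i.
  by rewrite mem_enum.
have h0 : 0 <= 1 / 2 :> R by rewrite divr_ge0.
have h1 : 1 / 2 <= 1 :> R by rewrite ler_pdivrMr// mul1r ler1n.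
have h3 : 1 <= 3 / 2 :> R by rewrite ler_pdivlMr// mul1r ler_nat.
have := iter_discretized mm0 h0 h1 h3 (enum 'I_s) gd point.
rewrite sampleE size_enum_ord -integral_product_measure//; last 2 first.
- by case: gd => mg _ _; exact/measurable_EFinP.
- by move=> x; rewrite lee_fin powR_ge0.
by rewrite poweR_Lnorm ?gt_eqF.
Qed.
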